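(* Let $\Gamma=(\mathcal{V},\mathcal{E})$ be a finite simplicial graph, let $G_\Gamma$ be the associated right-angled Artin group, let $L=\mathcal{V}\cup\mathcal{V}^{-1}$, and let $H$ be the subgroup of $\mathrm{Aut}(G_\Gamma)$ generated by the partial conjugations. Then $H$ has the presentation $\langle S\mid R\rangle$, where the generating set $S$ consists of the partial conjugations $c_{x,Y}$, for $x\in L$ and $Y$ a non-empty union of connected components of $\Gamma\setminus \mathrm{st}(v(x))$, and $R$ consists of the following relations (for all $c_{x,Y}, c_{x,Z}, c_{y,Z}\in S$ and $y\in L$ satisfying the indicated conditions): 1. $(c_{x,Y})^{-1}=c_{x^{-1},Y}$; 2. $c_{x,Y}\,c_{x,Z}=c_{x,Y\cup Z}$ if $Y\cap Z=\emptyset$; 3. $c_{x,Y}\,c_{y,Z}=c_{y,Z}\,c_{x,Y}$ if $v(x)\notin Z$, $v(y)\notin Y$, $x\neq y,y^{-1}$, and at least one of $Y\cap Z=\emptyset$ or $y\in \mathrm{lk}_L(x)$ holds; 4. $\omega_y\,c_{x,Y}\,\omega_y^{-1}=c_{x,Y}$ if $v(y)\notin Y$ and $x\neq y,y^{-1}$. That is, the homomorphism from the abstract group $\langle S\mid R\rangle$ to $H$ sending each generator symbol $c_{x,Y}$ to the partial conjugation $c_{x,Y}$ is well defined and is an isomorphism. (In relation 4, $\omega_y$ stands for the generator $c_{y,\mathcal{V}\setminus \mathrm{st}(v(y))}$, or for the identity if $\mathrm{st}(v(y))=\mathcal{V}$.)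
   Context: The right-angled Artin group of $\Gamma=(\mathcal{V},\mathcal{E})$ is $G_\Gamma=\langle \mathcal{V}\mid vw=wv \text{ for all }\{v,w\}\in\mathcal{E}\rangle$. For a vertex $v$, the link $\mathrm{lk}(v)$ is the set of vertices adjacent to $v$, and the star is $\mathrm{st}(v)=\mathrm{lk}(v)\cup\{v\}$. For a set of vertices $A$, $\Gamma\setminus A$ denotes the full subgraph of $\Gamma$ spanned by $\mathcal{V}\setminus A$; a union of connected components of it is regarded as a set of vertices. For $x\in L=\mathcal{V}\cup\mathcal{V}^{-1}$ (generators and their formal inverses), $v(x)$ is the unique element of $\mathcal{V}\cap\{x,x^{-1}\}$, and $\mathrm{lk}_L(x)=\mathrm{lk}(v(x))\cup \mathrm{lk}(v(x))^{-1}$. Partial conjugation: for $x\in L$ and $Y$ a non-empty union of connected components of $\Gamma\setminus\mathrm{st}(v(x))$, $c_{x,Y}$ is the automorphism of $G_\Gamma$ that sends each vertex $y\in Y$ to $x^{-1}yx$ and fixes every vertex not in $Y$. Inner automorphism: for $y\in L$, $\omega_y$ is the inner automorphism $g\mapsto y^{-1}gy$ of $G_\Gamma$. It coincides with the partial conjugation $c_{y,\mathcal{V}\setminus\mathrm{st}(v(y))}$ when $\mathrm{st}(v(y))\ne\mathcal{V}$, and is trivial otherwise. Products in $\mathrm{Aut}(G_\Gamma)$ are compositions of maps. By a theorem of Laurence, $H$ is also the group of all vertex-conjugating automorphisms, i.e. those $\varphi\in\mathrm{Aut}(G_\Gamma)$ such that $\varphi(v)$ is conjugate to $v$ for all $v\in\mathcal{V}$.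 *)

(* Defs.v *)
From HB Require Import structures.
From mathcomp Require Import all_boot.
From mathcomp Require Import boolp.

Set Implicit Arguments.
Unset Strict Implicit.
Unset Printing Implicit Defensive.

(* Letters and words over S and S^-1: (s, false) is s, and (s, true) is s^-1. *)
Notation letter S := (S * bool)%type.
Notation word S := (seq (letter S)).

Definition linv (S : Type) (l : letter S) : letter S := (l.1, ~~ l.2).

Definition wgen (S : Type) (s : S) : word S := [:: (s, false)].

Definition winv (S : Type) (w : word S) : word S := rev (map (@linv S) w).

(* The elements of < S | R > are the words modulo the least congruence that
   contains the relations (pairs of words) in R and free cancellation. *)
Inductive word_eq (S : Type) (R : word S -> word S -> Prop) :
    word S -> word S -> Prop :=
| word_eq_refl w : word_eq R w w
| word_eq_sym w1 w2 : word_eq R w1 w2 -> word_eq R w2 w1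
| word_eq_trans w1 w2 w3 : word_eq R w1 w2 -> word_eq R w2 w3 -> word_eq R w1 w3
| word_eq_cat w1 w2 w3 w4 :
    word_eq R w1 w2 -> word_eq R w3 w4 -> word_eq R (w1 ++ w3) (w2 ++ w4)
| word_eq_cancel l : word_eq R [:: l; linv l] [::]
| word_eq_rel w1 w2 : R w1 w2 -> word_eq R w1 w2.

Section Presented.
Variables (S : choiceType) (R : word S -> word S -> Prop).

Definition word_eqb : rel (word S) := fun w1 w2 => `[< word_eq R w1 w2 >].

Lemma word_eqb_refl : reflexive word_eqb.
Proof. by move=> w; apply/asboolP; exact: word_eq_refl. Qed.

Lemma word_eqb_sym : symmetric word_eqb.
Proof.
by move=> a b; apply/asboolP/asboolP => h; exact: word_eq_sym.
Qed.

Lemma word_eqb_trans : transitive word_eqb.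
Proof.
move=> b a c /asboolP hab /asboolP hbc; apply/asboolP.
exact: word_eq_trans hab hbc.
Qed.

Canonical word_equiv := EquivRel word_eqb word_eqb_refl word_eqb_sym word_eqb_trans.

Definition presented : Type := {eq_quot word_equiv}%qT.
HB.instance Definition _ := Choice.on presented.

Definition pclass (w : word S) : presented := (\pi_({eq_quot word_equiv}) w)%qT.
Definition prepr (u : presented) : word S := repr (u : {eq_quot word_equiv}%qT).

Lemma preprK u : pclass (prepr u) = u.
Proof. exact: reprK. Qed.

Lemma pclassP w1 w2 : pclass w1 = pclass w2 <-> word_eq R w1 w2.
Proof. by split => [/eqmodP/asboolP | h] //; apply/eqmodP/asboolP. Qed.

Lemma prepr_class w : word_eq R (prepr (pclass w)) w.
Proof. by apply/pclassP; rewrite preprK. Qed.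

Lemma linvK : involutive (@linv S).
Proof. by case=> s b; rewrite /linv /= negbK. Qed.

Lemma winvK : involutive (@winv S).
Proof.
by move=> w; rewrite /winv map_rev revK -map_comp -[RHS]map_id; apply: eq_map => l /=;
  rewrite linvK.
Qed.

Lemma winv_cat (w1 w2 : word S) : winv (w1 ++ w2) = winv w2 ++ winv w1.
Proof. by rewrite /winv map_cat rev_cat. Qed.

Lemma word_eq_mulV w : word_eq R (w ++ winv w) [::].
Proof.
elim: w => [|l w IH]; first exact: word_eq_refl.
have -> : winv (l :: w) = winv w ++ [:: linv l].
  by rewrite -cat1s winv_cat.
apply: word_eq_trans (word_eq_cancel R l).
rewrite -cat1s -catA -[[:: l; linv l]]/([:: l] ++ ([::] ++ [:: linv l])).
apply: word_eq_cat; first exact: word_eq_refl.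
by rewrite catA; apply: word_eq_cat => //; exact: word_eq_refl.
Qed.

Lemma word_eq_Vmul w : word_eq R (winv w ++ w) [::].
Proof. by have := word_eq_mulV (winv w); rewrite winvK. Qed.

Lemma word_eq_inv w1 w2 : word_eq R w1 w2 -> word_eq R (winv w1) (winv w2).
Proof.
move=> h.
have h1 : word_eq R (winv w1) (winv w1 ++ (w2 ++ winv w2)).
  rewrite -{1}[winv w1]cats0; apply: word_eq_cat; first exact: word_eq_refl.
  exact/word_eq_sym/word_eq_mulV.
apply: word_eq_trans h1 _; rewrite catA -{2}[winv w2]cat0s.
apply: word_eq_cat; last exact: word_eq_refl.
apply: word_eq_trans (word_eq_Vmul w1).
by apply: word_eq_cat; [exact: word_eq_refl | exact: word_eq_sym].
Qed.

Definition pres_one : presented := pclass [::].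
Definition pres_mul (u v : presented) : presented := pclass (prepr u ++ prepr v).
Definition pres_inv (u : presented) : presented := pclass (winv (prepr u)).

Lemma pclassM w1 w2 : pclass (w1 ++ w2) = pres_mul (pclass w1) (pclass w2).
Proof.
by apply/pclassP/word_eq_sym; apply: word_eq_cat; exact: prepr_class.
Qed.

Lemma pclassV w : pclass (winv w) = pres_inv (pclass w).
Proof. by apply/pclassP/word_eq_sym/word_eq_inv; exact: prepr_class. Qed.

Lemma pres_mulA : associative pres_mul.
Proof.
move=> u v w; rewrite -(preprK u) -(preprK v) -(preprK w).
by rewrite -!pclassM catA.
Qed.

Lemma pres_mul1 : left_id pres_one pres_mul.
Proof. by move=> u; rewrite -(preprK u) -pclassM. Qed.

Lemma pres_mulr1 : right_id pres_one pres_mul.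
Proof. by move=> u; rewrite -(preprK u) -pclassM cats0. Qed.

Lemma pres_mulV : left_inverse pres_one pres_inv pres_mul.
Proof.
move=> u; rewrite -(preprK u) -pclassV -pclassM; apply/pclassP.
exact: word_eq_Vmul.
Qed.

Lemma pres_mulrV : right_inverse pres_one pres_inv pres_mul.
Proof.
move=> u; rewrite -(preprK u) -pclassV -pclassM; apply/pclassP.
exact: word_eq_mulV.
Qed.

HB.instance Definition _ := isGroup.Build presented
  pres_mulA pres_mul1 pres_mulr1 pres_mulV pres_mulrV.

Definition pgen (s : S) : presented := pclass (wgen s).

End Presented.

Local Open Scope group_scope.

Section Lift.
Variables (S : choiceType) (R : word S -> word S -> Prop) (G : groupType).
Variable f : S -> G.

Definition leval (l : letter S) : G := if l.2 then (f l.1)^-1 else f l.1.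

Definition weval (w : word S) : G := \prod_(l <- w) leval l.

Definition respects_rel : Prop := forall w1 w2, R w1 w2 -> weval w1 = weval w2.

Definition pres_lift (u : presented R) : G := weval (prepr u).

Lemma weval_cat w1 w2 : weval (w1 ++ w2) = weval w1 * weval w2.
Proof. by rewrite /weval big_cat. Qed.

Hypothesis fR : respects_rel.

Lemma weval_eq w1 w2 : word_eq R w1 w2 -> weval w1 = weval w2.
Proof.
elim=> {w1 w2} //.
- by move=> w1 w2 w3 _ -> _ ->.
- by move=> w1 w2 w3 w4 _ h1 _ h2; rewrite !weval_cat h1 h2.
- case=> s b; rewrite /weval !big_cons big_nil mulg1 /leval /linv /=.
  by case: b; rewrite /= ?mulVg ?mulgV.
Qed.

Lemma pres_lift_class w : pres_lift (pclass R w) = weval w.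
Proof. by apply: weval_eq; exact: prepr_class. Qed.

Lemma pres_liftM : {morph pres_lift : u v / u * v}.
Proof. by move=> u v; rewrite [LHS]pres_lift_class weval_cat. Qed.

Lemma pres_lift_gen s : pres_lift (pgen R s) = f s.
Proof. by rewrite pres_lift_class /weval big_seq1. Qed.

End Lift.

Lemma pres_morph_eq (S : choiceType) (R : word S -> word S -> Prop)
    (G : groupType) (f g : presented R -> G) :
  {morph f : u v / u * v} -> {morph g : u v / u * v} ->
  (forall s, f (pgen R s) = g (pgen R s)) -> f =1 g.
Proof.
move=> fM gM fg.
have morph1 (h : presented R -> G) : {morph h : u v / u * v} -> h 1 = 1.
  by move=> hM; apply: (@mulgI _ (h 1)); rewrite -hM !mulg1.
have morphV (h : presented R -> G) u : {morph h : u v / u * v} ->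
    h u^-1 = (h u)^-1.
  by move=> hM; apply: (@mulgI _ (h u)); rewrite -hM !mulgV morph1.
move=> u; rewrite -(preprK u); elim: (prepr u) => [|[s b] w IH].
  by rewrite (morph1 f fM) (morph1 g gM).
have e : pclass R ((s, b) :: w) = pclass R [:: (s, b)] * pclass R w.
  by rewrite -cat1s; exact: pclassM.
rewrite e fM gM IH; congr (_ * _).
case: b {e}; last exact: fg.
have -> : pclass R [:: (s, true)] = (pgen R s)^-1 by exact: pclassV R (wgen s).
by rewrite (morphV f) // (morphV g) // fg.
Qed.

(* The inverse map is a field of the record, which makes the group structure
   computable; it is determined by the underlying map. *)
Record aut (G : groupType) : Type := Aut {
  aut_fun :> G -> G;
  aut_inv : G -> G;
  autM : {morph aut_fun : x y / x * y};
  autK : cancel aut_fun aut_inv;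
  autVK : cancel aut_inv aut_fun }.

HB.instance Definition _ (G : groupType) := gen_eqMixin (aut G).
HB.instance Definition _ (G : groupType) := gen_choiceMixin (aut G).

Section AutGroup.
Variable G : groupType.

Lemma aut_eq (a b : aut G) : a =1 b -> a = b.
Proof.
case: a b => [f f' fM fK f'K] [g g' gM gK g'K] /= /funext fg; subst g.
have fg' : f' = g' by apply: funext => x; rewrite -{1}(g'K x) fK.
subst g'; by congr Aut; exact: Prop_irrelevance.
Qed.

Definition aut_one : aut G :=
  @Aut G id id (fun _ _ => erefl) (fun _ => erefl) (fun _ => erefl).

Lemma aut_mulM (a b : aut G) : {morph (a \o b) : x y / x * y}.
Proof. by move=> x y /=; rewrite !autM. Qed.

Definition aut_mul (a b : aut G) : aut G :=
  Aut (aut_mulM a b) (can_comp (@autK G a) (@autK G b))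
    (can_comp (@autVK G b) (@autVK G a)).

Lemma aut_invM (a : aut G) : {morph (aut_inv a) : x y / x * y}.
Proof. by move=> x y; apply: (can_inj (@autK G a)); rewrite autM !autVK. Qed.

Definition aut_inverse (a : aut G) : aut G :=
  Aut (aut_invM a) (@autVK G a) (@autK G a).

Lemma aut_mulA : associative aut_mul.
Proof. by move=> a b c; exact: aut_eq. Qed.

Lemma aut_mul1 : left_id aut_one aut_mul.
Proof. by move=> a; exact: aut_eq. Qed.

Lemma aut_mulr1 : right_id aut_one aut_mul.
Proof. by move=> a; exact: aut_eq. Qed.

Lemma aut_mulV : left_inverse aut_one aut_inverse aut_mul.
Proof. by move=> a; apply: aut_eq => x /=; rewrite autK. Qed.

Lemma aut_mulrV : right_inverse aut_one aut_inverse aut_mul.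
Proof. by move=> a; apply: aut_eq => x /=; rewrite autVK. Qed.

HB.instance Definition _ := isGroup.Build (aut G)
  aut_mulA aut_mul1 aut_mulr1 aut_mulV aut_mulrV.

End AutGroup.

Inductive generated (G : groupType) (A : G -> Prop) : G -> Prop :=
| generated_in a : A a -> generated A a
| generated_one : generated A 1
| generated_mul a b : generated A a -> generated A b -> generated A (a * b)
| generated_inv a : generated A a -> generated A a^-1.

Record sgraph : Type := SGraph {
  vertex :> finType;
  adj : rel vertex;
  adj_sym : symmetric adj;
  adj_irrefl : irreflexive adj }.

Section RAAG.
Variable Gamma : sgraph.
Implicit Types (v w : Gamma) (A Y Z : {set Gamma}) (x y : letter Gamma).

Inductive raag_rel : word Gamma -> word Gamma -> Prop :=
| raag_comm v w : adj v w -> raag_rel (wgen v ++ wgen w) (wgen w ++ wgen v).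

Definition raag : groupType := presented raag_rel.

Definition vgen v : raag := pgen raag_rel v.

Definition lk v : {set Gamma} := [set w | adj v w].
Definition st v : {set Gamma} := v |: lk v.

Definition lkL x : {set letter Gamma} := [set y : letter Gamma | y.1 \in lk x.1].

(* The vertex sets of the components of the full subgraph spanned by A. *)
Definition components A : {set {set Gamma}} :=
  equivalence_partition
    (connect [rel v w | [&& v \in A, w \in A & adj v w]]) A.

Definition union_of_components A Y : bool :=
  [exists P : {set {set Gamma}}, (P \subset components A) && (Y == cover P)].

Definition is_pc_symbol (p : letter Gamma * {set Gamma}) : bool :=
  (p.2 != set0) && union_of_components (~: st p.1.1) p.2.

Definition pc_symbol : choiceType := {p : letter Gamma * {set Gamma} | is_pc_symbol p}.

Definition lgen x : raag := leval vgen x.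

Definition pc_gen x Y v : raag := if v \in Y then vgen v ^ lgen x else vgen v.

Definition pc_fun x Y : raag -> raag := pres_lift (pc_gen x Y).

Lemma union_of_components_sub A Y : union_of_components A Y -> Y \subset A.
Proof.
case/existsP => P /andP[sP /eqP ->]; apply/bigcupsP => B /(subsetP sP).
by case/imsetP => v _ ->; apply/subsetP => w; rewrite inE => /andP[].
Qed.

Lemma union_of_components_closed A Y v w : union_of_components A Y ->
  v \in Y -> w \in A -> adj v w -> w \in Y.
Proof.
move=> hY vY wA vw; have vA := subsetP (union_of_components_sub hY) _ vY.
case/existsP: hY vY => P /andP[sP /eqP ->] /bigcupP[B BP vB].
apply/bigcupP; exists B => //; case/imsetP: (subsetP sP _ BP) vB => u _ ->.
rewrite !inE wA => /andP[_ uv] /=; apply: connect_trans uv (connect1 _).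
by rewrite /= vA wA.
Qed.

Lemma is_pc_symbolC v b : st v != setT -> is_pc_symbol ((v, b), ~: st v).
Proof.
move=> h; rewrite /is_pc_symbol /= -setCT (inj_eq (@setC_inj _)) h /=.
apply/existsP; exists (components (~: st v)); rewrite subxx eqEsubset /=.
apply/andP; split; apply/subsetP => w.
  move=> wA; apply/bigcupP.
  exists [set u in ~: st v | connect [rel v0 w0 |
    [&& v0 \in ~: st v, w0 \in ~: st v & adj v0 w0]] w u].
    exact: imset_f.
  by rewrite inE wA connect0.
by case/bigcupP => B /imsetP[u _ ->]; rewrite inE => /andP[].
Qed.

Lemma vgen_comm v w : adj v w -> commute (vgen v) (vgen w).
Proof.
move=> vw; have := word_eq_rel (raag_comm vw) => /pclassP.
by rewrite !pclassM.
Qed.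

Lemma lgen_comm x v : adj x.1 v -> commute (lgen x) (vgen v).
Proof.
case: x => u [] /= /vgen_comm c; rewrite /lgen /leval /= //.
by apply: commute_sym; apply: commuteV; exact: commute_sym.
Qed.

Lemma pc_gen_respects x Y : union_of_components (~: st x.1) Y ->
  respects_rel raag_rel (pc_gen x Y).
Proof.
move=> hY _ _ [v w vw]; rewrite !weval_cat /weval !big_seq1 /leval /=.
suff half v' w' : adj v' w' -> v' \in Y ->
    commute (pc_gen x Y v') (pc_gen x Y w').
  have [vY|vY] := boolP (v \in Y); first exact: half.
  have [wY|wY] := boolP (w \in Y).
    by apply: commute_sym; apply: half => //; rewrite adj_sym.
  by rewrite /pc_gen (negbTE vY) (negbTE wY); exact: vgen_comm.
move=> {v w vw}; move: v' w' => v w vw vY; rewrite /pc_gen vY.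
have [wY|wY] := boolP (w \in Y).
  by rewrite /commute -!conjMg (vgen_comm vw).
have : v \notin st x.1.
  by have := subsetP (union_of_components_sub hY) _ vY; rewrite inE.
rewrite !inE negb_or => /andP[_ xv].
have : w \in st x.1.
  apply: contraNT wY => wA.
  by apply: (union_of_components_closed hY vY _ vw); rewrite inE.
rewrite !inE => /orP[/eqP wx|xw].
  by case/negP: xv; rewrite adj_sym -wx.
have cx := lgen_comm xw; rewrite conjgE; apply: commute_sym.
apply: commuteM; first by apply: commuteV; exact: commute_sym.
apply: commuteM; last exact: commute_sym.
by apply: commute_sym; exact: vgen_comm.
Qed.

Lemma lgen_linv x : lgen (linv x) = (lgen x)^-1.
Proof. by case: x => v []; rewrite /lgen /leval /linv //= invgK. Qed.

Lemma pc_fun_lgen x Y : union_of_components (~: st x.1) Y ->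
  pc_fun x Y (lgen x) = lgen x.
Proof.
move=> hY; have fR := pc_gen_respects hY.
have fM : {morph pc_fun x Y : u v / u * v} := pres_liftM fR.
have xY : x.1 \notin Y.
  apply/negP => /(subsetP (union_of_components_sub hY)).
  by rewrite !inE eqxx.
have e : pc_fun x Y (vgen x.1) = vgen x.1.
  by rewrite /pc_fun /vgen pres_lift_gen // /pc_gen (negbTE xY).
case: x e {xY} fM fR hY => v [] //= e fM _ _.
have f1 : pc_fun (v, true) Y 1 = 1.
  by apply: (@mulgI _ (pc_fun (v, true) Y 1)); rewrite -fM !mulg1.
rewrite /lgen /leval /=; apply: (@mulgI _ (pc_fun (v, true) Y (vgen v))).
by rewrite -fM mulgV f1 e mulgV.
Qed.

Lemma pc_funK x Y : union_of_components (~: st x.1) Y ->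
  cancel (pc_fun x Y) (pc_fun (linv x) Y).
Proof.
move=> hY; have hY' : union_of_components (~: st (linv x).1) Y by [].
have fM : {morph pc_fun x Y : u v / u * v} := pres_liftM (pc_gen_respects hY).
have gM : {morph pc_fun (linv x) Y : u v / u * v} :=
  pres_liftM (pc_gen_respects hY').
move=> u; move: u; apply: pres_morph_eq => //.
  by move=> u v; rewrite /= fM gM.
move=> v /=; rewrite {2}/pc_fun (pres_lift_gen (pc_gen_respects hY)) -/(vgen v).
have e : pc_fun (linv x) Y (vgen v) = pc_gen (linv x) Y v.
  by rewrite /pc_fun /vgen pres_lift_gen //; exact: pc_gen_respects.
rewrite {1}/pc_gen; case: ifP => vY; last by rewrite e /pc_gen vY.
have ex := pc_fun_lgen hY'; rewrite lgen_linv in ex.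
have f1 : pc_fun (linv x) Y 1 = 1.
  by apply: (@mulgI _ (pc_fun (linv x) Y 1)); rewrite -gM !mulg1.
have ex' : pc_fun (linv x) Y (lgen x) = lgen x.
  by apply: (@mulgI _ (lgen x)^-1); rewrite -{1}ex -gM !mulVg f1.
rewrite conjgE !gM ex ex' e /pc_gen vY lgen_linv.
by rewrite -conjgE conjgKV.
Qed.

Lemma pc_funVK x Y : union_of_components (~: st x.1) Y ->
  cancel (pc_fun (linv x) Y) (pc_fun x Y).
Proof. by move=> hY; have := @pc_funK (linv x) Y hY; rewrite linvK. Qed.

Definition pc_base (s : pc_symbol) : letter Gamma := (val s).1.
Definition pc_supp (s : pc_symbol) : {set Gamma} := (val s).2.

Lemma pc_supp_union (s : pc_symbol) :
  union_of_components (~: st (pc_base s).1) (pc_supp s).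
Proof. by case/andP: (valP s). Qed.

Definition partial_conj (s : pc_symbol) : aut raag :=
  Aut (pres_liftM (pc_gen_respects (pc_supp_union s)))
    (pc_funK (pc_supp_union s)) (pc_funVK (pc_supp_union s)).

Lemma partial_conjE (s : pc_symbol) v :
  partial_conj s (vgen v) =
  if v \in pc_supp s then (lgen (pc_base s))^-1 * vgen v * lgen (pc_base s)
  else vgen v.
Proof.
rewrite /= /pc_fun /vgen pres_lift_gen; last exact/pc_gen_respects/pc_supp_union.
by rewrite /pc_gen conjgE mulgA.
Qed.

Definition pc_group : aut raag -> Prop :=
  generated (fun a => exists s, a = partial_conj s).

(* By omegaE and omega1 below, the default value [::] is used exactly when
   st(v(y)) is the whole vertex set. *)
Definition omega y : word pc_symbol :=
  if insub (y, ~: st y.1) is Some s then wgen s else [::].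

Lemma omegaE y : st y.1 != setT ->
  exists s : pc_symbol,
    [/\ pc_base s = y, pc_supp s = ~: st y.1 & omega y = wgen s].
Proof.
case: y => v b /(is_pc_symbolC b) h; exists (Sub _ h); rewrite /omega insubT.
by split; rewrite // /pc_base /pc_supp SubK.
Qed.

Lemma omega1 y : st y.1 = setT -> omega y = [::].
Proof.
by move=> e; rewrite /omega insubF // /is_pc_symbol /= e setCT eqxx.
Qed.

Inductive pc_rel : word pc_symbol -> word pc_symbol -> Prop :=
| pc_rel_inv (c c' : pc_symbol) :
    pc_base c' = linv (pc_base c) -> pc_supp c' = pc_supp c ->
    pc_rel (winv (wgen c)) (wgen c')
| pc_rel_union (c d e : pc_symbol) :
    pc_base d = pc_base c -> pc_base e = pc_base c ->
    [disjoint pc_supp c & pc_supp d] ->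
    pc_supp e = pc_supp c :|: pc_supp d ->
    pc_rel (wgen c ++ wgen d) (wgen e)
| pc_rel_comm (c d : pc_symbol) :
    (pc_base c).1 \notin pc_supp d -> (pc_base d).1 \notin pc_supp c ->
    pc_base c <> pc_base d -> pc_base c <> linv (pc_base d) ->
    [disjoint pc_supp c & pc_supp d] \/ pc_base d \in lkL (pc_base c) ->
    pc_rel (wgen c ++ wgen d) (wgen d ++ wgen c)
| pc_rel_omega (c : pc_symbol) y :
    y.1 \notin pc_supp c -> pc_base c <> y -> pc_base c <> linv y ->
    pc_rel (omega y ++ wgen c ++ winv (omega y)) (wgen c).

End RAAG.

(* Main.v *)
From HB Require Import structures.
Require Import Defs.
From mathcomp Require Import all_boot all_algebra fingroup perm.
From mathcomp Require Import boolp zify.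

(* Let C(v) be the centralizer of the vertex v. For a vertex x the displacement
   [disp x] : G -> Z counts the letters x^{+-1} of a word that are read while its
   remaining suffix lies in C(x); it is a coordinate along the axis of x in the
   Bass-Serre tree of the HNN splitting with stable letter x, and is well defined
   without any normal form for G. If phi v = v ^ g_v for all v, the integers
   [slab phi x v] = disp x (g_v g_x^-1) - disp x (g_x^-1), for v outside st(x), do
   not depend on the choice of the g_v and are constant on the components of
   Gamma \ st(x). A word for g_v along which this coordinate moves in the direction
   of x^-1 has the form u1 x^-1 u2 with phi x = x ^ u2, so that conjugating phi v
   by phi x cancels the letter x^-1. Hence multiplying phi on the right by c_{x,C},
   for one component C, always changes the total length of the shortest g_v: it
   decreases if the slab coordinate of C moves towards 0, and increases otherwise.

   Now take a path in the Cayley graph of < S | R > that ends at length 0, and a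
   vertex of maximal length on it. The two decreasing moves there can be replaced
   by a path through shorter vertices: if they do not commute, then up to symmetry
   y is displaced along the axis of x in the same direction as C, and c_{x,C} can
   be enlarged to a c_{x,Y} whose complement in Gamma \ st(x) avoids y and the
   support of the other move; relations 3 and 4 then make the two commute. *)

Set Implicit Arguments.
Unset Strict Implicit.
Unset Printing Implicit Defensive.

Local Open Scope group_scope.

(** * Centralizers and conjugation in a group *)

Lemma commute_mulr (G : groupType) (x a b : G) :
  commute x a -> commute x (a * b) <-> commute x b.
Proof.
move=> xa; split=> [xab|]; last exact: commuteM.
by rewrite -(mulKg a b); apply: commuteM => //; exact: commuteV.
Qed.

Lemma commute_mull (G : groupType) (x a b : G) :
  commute x b -> commute x (a * b) <-> commute x a.
Proof.
move=> xb; split=> [xab|/commuteM]; last exact.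
by rewrite -(mulgK b a); apply: commuteM => //; exact: commuteV.
Qed.

Lemma conjg_eq_commute (G : groupType) (x a b : G) :
  x ^ a = x ^ b <-> commute x (a * b^-1).
Proof.
split=> [e|c].
  apply: (@mulgI _ (a * b^-1)^-1); rewrite -[LHS]conjgE conjgM e conjgK.
  by rewrite mulKg.
rewrite -{1}(mulgVK b a) conjgM; congr (_ ^ _).
by rewrite conjgE c mulKg.
Qed.

(** * The displacement cocycle attached to a vertex *)

Section Cocycle.
Variable Gamma : sgraph.
Implicit Types (v w x y : Gamma) (a : letter Gamma) (u : word Gamma).
Implicit Types (g b k : raag Gamma).

Notation gw := (pclass (@raag_rel Gamma)).

Definition sgl a : int := if a.2 then (-1)%R else 1%R.

Lemma sgl_linv a : sgl (linv a) = (- sgl a)%R.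
Proof. by case: a => v []; rewrite /sgl /= ?GRing.opprK. Qed.

Lemma gw1 a : gw [:: a] = lgen a :> raag Gamma.
Proof. by case: a => v [] //; exact: pclassV _ (wgen v). Qed.

Lemma gw_cons a u : gw (a :: u) = lgen a * gw u :> raag Gamma.
Proof. by rewrite -cat1s -gw1; exact: pclassM. Qed.

Lemma gw_cat u1 u2 : gw (u1 ++ u2) = gw u1 * gw u2 :> raag Gamma.
Proof. exact: pclassM. Qed.

Lemma lgen_commP a g :
  commute (vgen a.1) g -> commute (lgen a) g.
Proof.
case: a => v [] //= c; rewrite /lgen /leval /=.
by apply: commute_sym; apply: commuteV; exact: commute_sym.
Qed.

(* [crossings x u k] counts, with signs, the moments at which the path
   k, ..., [u] k in the Cayley graph runs along an edge of the coset C(x) that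
   is labelled by x: it is the displacement of the path along the axis of x in
   the Bass-Serre tree of the HNN decomposition with stable letter x. *)
Fixpoint crossings x u k : int :=
  if u is a :: u' then
    ((if (a.1 == x) && `[< commute (vgen x) (gw u' * k) >] then sgl a else 0)
       + crossings x u' k)%R
  else 0%R.

Lemma crossings_cat x u1 u2 k :
  crossings x (u1 ++ u2) k = (crossings x u1 (gw u2 * k) + crossings x u2 k)%R.
Proof.
elim: u1 => [|a u1 IH] /=; first by rewrite GRing.add0r.
by rewrite IH GRing.addrA gw_cat mulgA.
Qed.

(** Two cancelling letters [x] are both counted or both skipped, with opposite signs. When adjacent
    [v] and [w] are swapped, the letter passed over commutes with the counted one and leaves its
    test unchanged. *)
Lemma crossings_eq x u1 u2 k :
  word_eq (@raag_rel Gamma) u1 u2 -> crossings x u1 k = crossings x u2 k.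
Proof.
move=> e; elim: e k => {u1 u2} // [? ? ? _ IH1 _ IH2 k|||? ? [v w vw] k].
- by rewrite IH1.
- move=> u1 u2 u3 u4 _ IH1 e34 IH2 k; rewrite !crossings_cat IH1 IH2.
  by have /pclassP -> := e34.
- move=> a k /=; rewrite GRing.addr0 gw1 mul1g /=.
  have [ax|//] := eqVneq a.1 x.
  rewrite /= (_ : `[< _ >] = `[< commute (vgen x) k >]).
    by case: asboolP => // _; rewrite sgl_linv GRing.addrN.
  apply: asbool_equiv_eq; apply: commute_mulr; apply: commute_sym.
  by rewrite -ax; apply: (@lgen_commP (linv a)).
- rewrite /= !GRing.addr0 !gw1 !mul1g.
  suff half v' w' : adj v' w' ->
      `[< commute (vgen v') (lgen (w', false) * k) >] = `[< commute (vgen v') k >].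
    have [vx|vx] := eqVneq v x; have [wx|wx] := eqVneq w x => //=;
      rewrite ?GRing.addr0 ?GRing.add0r //.
    + by move: vw; rewrite vx wx adj_irrefl.
    + by rewrite -vx half.
    + by rewrite -wx half // adj_sym.
  move=> vw'; apply: asbool_equiv_eq; apply: commute_mulr; exact: vgen_comm.
Qed.

Definition disp x g : int := crossings x (prepr g) 1.

Lemma disp_gw x u : disp x (gw u) = crossings x u 1.
Proof. by apply: crossings_eq; exact: prepr_class. Qed.

Lemma crossingsE x u k : crossings x u k = (disp x (gw u * k) - disp x k)%R.
Proof.
rewrite -[X in gw u * X]preprK -gw_cat disp_gw crossings_cat preprK mulg1.
by rewrite /disp GRing.addrK.
Qed.

Lemma disp1 x : disp x 1 = 0%R.
Proof. exact: disp_gw x [::]. Qed.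

Lemma disp_lgen_mul x a k :
  disp x (lgen a * k) =
  ((if (a.1 == x) && `[< commute (vgen x) k >] then sgl a else 0) + disp x k)%R.
Proof.
have := crossingsE x [:: a] k; rewrite gw1 /= mul1g GRing.addr0 => ->.
by rewrite GRing.subrK.
Qed.

(** Appending an element of the centralizer of [x] on the right does not change which letters are
    counted. *)
Lemma disp_mulr x k b : commute (vgen x) b ->
  disp x (k * b) = (disp x k + disp x b)%R.
Proof.
move=> xb; rewrite -(preprK k); elim: (prepr k) => [|a u IH].
  by rewrite mul1g disp1 GRing.add0r.
rewrite gw_cons -mulgA !disp_lgen_mul IH GRing.addrA; congr (_ + _ + _)%R.
congr (if _ && _ then _ else _); apply: asbool_equiv_eq; exact: commute_mull.
Qed.

Lemma disp_lgen x a : disp x (lgen a) = if a.1 == x then sgl a else 0%R.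
Proof.
rewrite -[lgen a]mulg1 disp_lgen_mul disp1 GRing.addr0.
by rewrite (asboolT (commute1 _)) andbT.
Qed.

End Cocycle.

(** * Dihedral permutations of a cyclic group of odd order *)

Section Dihedral.
Variable n : nat.

(** The modulus is odd, so that negation fixes only 0, and exceeds [n], so that for positive [n] the
    [n]-th power of the rotation fixes no point. *)
Definition dihedral_flip : {perm 'Z_n.*2.+3} := perm (@GRing.oppr_inj 'Z_n.*2.+3).
Definition dihedral_rot : {perm 'Z_n.*2.+3} := perm (@GRing.addrI 'Z_n.*2.+3 1%R).

Lemma dihedral_rotX d t : (dihedral_rot ^+ d) t = (d%:R + t)%R.
Proof.
elim: d t => [|d IH] t; first by rewrite perm1 GRing.add0r.
by rewrite expgSr permM IH permE GRing.addrA -GRing.mulrS.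
Qed.

Lemma dihedral_flip_fix t : dihedral_flip t = t -> t = 0%R.
Proof.
rewrite permE => /= tN.
have t2 : (t *+ 2 = 0)%R by rewrite GRing.mulr2n -{1}tN GRing.addNr.
have odd_mul m : (t *+ m.*2.+3 = t)%R.
  have -> : m.*2.+3 = (2 * m.+1).+1 by lia.
  by rewrite GRing.mulrS GRing.mulrnA t2 GRing.mul0rn GRing.addr0.
by rewrite -(odd_mul n) -GRing.mulr_natr pchar_Zp // GRing.mulr0.
Qed.

End Dihedral.

(** * Invariance of displacement under centralizers of vertices outside the star *)

Section Displacement.
Variable Gamma : sgraph.
Implicit Types (v w x y : Gamma) (a : letter Gamma) (u : word Gamma).
Implicit Types (g b k : raag Gamma).

Notation gw := (pclass (@raag_rel Gamma)).

(* In the dihedral quotient that kills all vertices but x and v, every conjugate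
   of x has a unique fixed point and v ^+ d has none. *)
Lemma power_conj_not_commute x v d k : x != v -> ~~ adj x v -> 0 < d ->
  ~ commute (vgen x) ((vgen v ^+ d) ^ k).
Proof.
move=> xv nxv d0 xvk.
pose f w : {perm 'Z_d.*2.+3} :=
  if w == x then dihedral_flip d else if w == v then dihedral_rot d else 1.
have fR : respects_rel (@raag_rel Gamma) f.
  move=> _ _ [w w' ww']; rewrite !weval_cat /weval !big_seq1 /leval /f /=.
  have [wx|_] := eqVneq w x; have [w'x|_] := eqVneq w' x => //.
  - have [w'v|_] := eqVneq w' v; last by rewrite mulg1 mul1g.
    by move: ww' nxv; rewrite wx w'v => ->.
  - have [wv|_] := eqVneq w v; last by rewrite mulg1 mul1g.
    by move: ww' nxv; rewrite w'x wv adj_sym => ->.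
  - by case: eqP; case: eqP => //; rewrite mulg1 mul1g.
pose F : raag Gamma -> _ := pres_lift f.
have FM : {morph F : g h / g * h} := pres_liftM fR.
have F1 : F 1 = 1 by apply: (@mulgI _ (F 1)); rewrite -FM !mulg1.
have FV g : F g^-1 = (F g)^-1 by apply: (@mulgI _ (F g)); rewrite -FM !mulgV.
have FX g m : F (g ^+ m) = F g ^+ m.
  by elim: m => [|m IH]; rewrite ?expg0 // !expgS FM IH.
have /(congr1 F) := xvk; rewrite !FM FV FX /F !pres_lift_gen // -/F.
rewrite /f eqxx eq_sym (negbTE xv) eqxx; set X := dihedral_flip d.
set V := _ ^+ d => XV.
have X0 : X 0%R = 0%R by rewrite permE /= GRing.oppr0.
have := congr1 (fun s : {perm _} => s 0%R) XV.
rewrite !permM X0 => /esym/dihedral_flip_fix /(congr1 (F k)^-1).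
rewrite permK dihedral_rotX => /eqP; rewrite -GRing.subr_eq0 GRing.addrK.
move/eqP/(congr1 val); rewrite /= val_Zp_nat // modn_small; last by lia.
by move=> d00; rewrite d00 in d0.
Qed.

(** A given letter of [u] is counted for at most one exponent [m]: two exponents would put a
    conjugate of a positive power of [v] into the centralizer of [x]. *)
Lemma crossings_eventually0 x v u k : x != v -> ~~ adj x v ->
  exists N, forall m, N <= m -> crossings x u (vgen v ^+ m * k) = 0%R.
Proof.
move=> xv nxv; elim: u => [|a u [N IH]]; first by exists 0.
have [[n cn]|nc] :=
    EM (exists n, commute (vgen x) (gw u * (vgen v ^+ n * k))); last first.
  exists N => m Nm /=; rewrite IH // asboolF ?andbF //.
  by move=> cm; apply: nc; exists m.
exists (maxn N n.+1) => m; rewrite geq_max => /andP[Nm nm] /=.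
rewrite IH // asboolF ?andbF // => cm.
have d0 : 0 < m - n by rewrite subn_gt0.
apply: (power_conj_not_commute (k := k) xv nxv d0).
have -> : (vgen v ^+ (m - n)) ^ k =
    (gw u * (vgen v ^+ n * k))^-1 * (gw u * (vgen v ^+ m * k)).
  rewrite conjgE !invgM -!mulgA mulKg; congr (_ * _).
  by rewrite -(subnKC (ltnW nm)) expgnDr -mulgA mulKg addKn.
by apply: commuteM => //; exact: commuteV.
Qed.

(** As [g] commutes with powers of [v], and left multiplication by these preserves [disp x], the
    crossings of [g] may be counted from [vgen v ^+ N * k] with [N] large, where there are none. *)
Lemma disp_centralizer x v g k : x != v -> ~~ adj x v ->
  commute (vgen v) g -> disp x (g * k) = disp x k.
Proof.
move=> xv nxv vg.
have dv m h : disp x (vgen v ^+ m * h) = disp x h.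
  elim: m h => [|m IH] h; first by rewrite mul1g.
  rewrite expgS -mulgA -[vgen v]/(lgen (v, false)) disp_lgen_mul /=.
  by rewrite eq_sym (negbTE xv) GRing.add0r IH.
have [N /(_ N (leqnn _))] := crossings_eventually0 (prepr g) k xv nxv.
rewrite crossingsE preprK dv mulgA.
have -> : g * vgen v ^+ N = vgen v ^+ N * g.
  by apply: commuteX; exact: commute_sym.
by rewrite -mulgA dv => /eqP; rewrite GRing.subr_eq0 => /eqP.
Qed.

End Displacement.

Section AutFacts.
Variables (G : groupType) (phi : aut G).

Lemma aut1 : phi 1 = 1.
Proof. by apply: (@mulgI _ (phi 1)); rewrite -autM !mulg1. Qed.

Lemma autV g : phi g^-1 = (phi g)^-1.
Proof. by apply: (@mulgI _ (phi g)); rewrite -autM !mulgV aut1. Qed.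

Lemma autJ g h : phi (g ^ h) = phi g ^ phi h.
Proof. by rewrite !conjgE !autM autV. Qed.

End AutFacts.

(** * Vertex-conjugating automorphisms, conjugator lengths and slab coordinates *)

Section VertexConj.
Variable Gamma : sgraph.
Implicit Types (v w x y : Gamma) (a : letter Gamma) (u : word Gamma).
Implicit Types (g h k : raag Gamma) (phi psi : aut (raag Gamma)).

Notation gw := (pclass (@raag_rel Gamma)).

Lemma notin_st x v : v \notin st x -> x != v /\ ~~ adj x v.
Proof. by rewrite !inE negb_or eq_sym => /andP[]. Qed.

Definition conj_by phi v g := phi (vgen v) = vgen v ^ g.

Lemma conj_by_lgen phi a g : conj_by phi a.1 g -> phi (lgen a) = lgen a ^ g.
Proof.
by case: a => v [] //= e; rewrite /lgen /leval /= autV e conjVg.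
Qed.

(** The common conjugator of adjacent vertices makes slab coordinates agree along edges; the case
    [v == w] provides a conjugator for each single vertex. *)
Definition vertex_conj phi :=
  forall v w, (v == w) || adj v w ->
  exists g, conj_by phi v g /\ conj_by phi w g.

Definition minimal_conj phi v u :=
  conj_by phi v (gw u) /\ forall u', conj_by phi v (gw u') -> size u <= size u'.

Definition cword phi v : word Gamma :=
  if pselect (exists u, minimal_conj phi v u) is left e then projT1 (cid e) else [::].

Definition clen phi v := size (cword phi v).

Lemma cwordP phi v : vertex_conj phi -> minimal_conj phi v (cword phi v).
Proof.
move=> vc; rewrite /cword; case: pselect => [e|]; first by case: cid.
have [g [vg _]] : exists g, conj_by phi v g /\ conj_by phi v g.
  by apply: vc; rewrite eqxx.
pose P n := `[< exists u, size u = n /\ conj_by phi v (gw u) >].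
have exP : exists n, P n.
  by exists (size (prepr g)); apply/asboolP; exists (prepr g); rewrite preprK.
case: (ex_minnP exP) => n /asboolP[u [su vu]] minn []; exists u; split=> // u' vu'.
by rewrite su; apply: minn; apply/asboolP; exists u'.
Qed.

Lemma cword_conj phi v : vertex_conj phi -> conj_by phi v (gw (cword phi v)).
Proof. by case/(cwordP v). Qed.

Lemma clen_min phi v u : vertex_conj phi ->
  conj_by phi v (gw u) -> clen phi v <= size u.
Proof. by case/(cwordP v) => _; exact. Qed.

Lemma clen_eq phi psi v : phi (vgen v) = psi (vgen v) -> clen phi v = clen psi v.
Proof.
move=> e; rewrite /clen /cword.
have -> // : minimal_conj phi v = minimal_conj psi v.
by rewrite /minimal_conj /conj_by e.
Qed.

(* The position on the axis of phi x, relative to the base point, of the slab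
   (between consecutive hyperplanes dual to the axis) that contains the
   centralizer coset of phi v. *)
Definition slab phi x v : int :=
  (disp x (gw (cword phi v) * (gw (cword phi x))^-1)
     - disp x (gw (cword phi x))^-1)%R.

(** Other conjugators bring in a left factor from the centralizer of [v], invisible to [disp x], and
    a right factor from that of [x], which shifts both terms equally. *)
Lemma slabE phi x v g h : vertex_conj phi -> v \notin st x ->
  conj_by phi v g -> conj_by phi x h ->
  slab phi x v = (disp x (g * h^-1) - disp x h^-1)%R.
Proof.
move=> vc /notin_st[xv nxv] vg xh; rewrite /slab.
have := cword_conj v vc; have := cword_conj x vc.
move: (gw (cword phi x)) (gw (cword phi v)) => h' g' xh' vg'.
have xhh' : commute (vgen x) (h / h') by apply/conjg_eq_commute; rewrite -xh -xh'.
have vgg' : commute (vgen v) (g' / g) by apply/conjg_eq_commute; rewrite -vg -vg'.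
have -> : g' / h' = (g' / g) * ((g / h) * (h / h')) by rewrite !mulgA !mulgVK.
have -> : disp x h'^-1 = (disp x h^-1 + disp x (h / h'))%R.
  by rewrite -disp_mulr // mulKg.
by rewrite (disp_centralizer _ xv nxv vgg') disp_mulr //; lia.
Qed.

Lemma slab_eq phi psi x v : phi (vgen x) = psi (vgen x) ->
  phi (vgen v) = psi (vgen v) -> slab phi x v = slab psi x v.
Proof.
have eqc w : phi (vgen w) = psi (vgen w) -> cword phi w = cword psi w.
  by move=> e; rewrite /cword /minimal_conj /conj_by e.
by move=> /eqc ex /eqc ev; rewrite /slab ex ev.
Qed.

Lemma slab_adj phi x v w : vertex_conj phi -> v \notin st x -> w \notin st x ->
  adj v w -> slab phi x v = slab phi x w.
Proof.
move=> vc vx wx vw; have [|g [vg wg]] := vc v w; first by rewrite vw orbT.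
by rewrite (slabE vc vx vg (cword_conj x vc)) (slabE vc wx wg (cword_conj x vc)).
Qed.

Lemma sgl_cases a : sgl a = 1%R \/ sgl a = (-1)%R.
Proof. by case: a => v []; rewrite /sgl; [right|left]. Qed.

Lemma crossing_cut a u k : (sgl a * crossings a.1 u k < 0)%R ->
  exists u1 u2, u = u1 ++ linv a :: u2 /\ commute (vgen a.1) (gw u2 * k).
Proof.
elim: u => [|b u IH] /=; first by rewrite GRing.mulr0.
case: ifP => [/andP[/eqP ba /asboolP c]|_ lt]; last first.
  have [|u1 [u2 [-> c]]] := IH; first by lia.
  by exists (b :: u1), u2.
have [-> _|nba lt] := eqVneq b (linv a); first by exists [::], u.
have eba : b = a.
  case: b a nba ba {IH c lt} => v i [w j] /= + vw; rewrite vw.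
  by case: i; case: j; rewrite // /linv /= eqxx.
have [|u1 [u2 [-> c']]] := IH; last by exists (b :: u1), u2.
by case: (sgl_cases a) lt; rewrite eba => ->; lia.
Qed.

(** A partial conjugation by [a] adds [sgl a] to the slab coordinate ([slab_mul_pc_aut]); the sign
    condition says that this moves it towards 0. *)
Definition toward phi a v := (sgl a * slab phi a.1 v < 0)%R.

Lemma toward_cut phi a v u : vertex_conj phi -> v \notin st a.1 ->
  toward phi a v -> conj_by phi v (gw u) ->
  exists u1 u2, [/\ u = u1 ++ linv a :: u2, conj_by phi a.1 (gw u2)
    & gw u * phi (lgen a) = gw (u1 ++ u2)].
Proof.
move=> vc va lt vu; have xh := cword_conj a.1 vc.
rewrite /toward (slabE vc va vu xh) -crossingsE in lt.
have [u1 [u2 [eu c]]] := crossing_cut lt; exists u1, u2.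
have xu2 : conj_by phi a.1 (gw u2).
  by rewrite /conj_by xh; apply/esym/conjg_eq_commute.
split=> //; rewrite (conj_by_lgen xu2) eu !gw_cat gw_cons lgen_linv conjgE.
by rewrite -!mulgA mulVKg mulKg.
Qed.

Lemma toward_clen phi psi a v : vertex_conj phi -> vertex_conj psi ->
  v \notin st a.1 -> toward phi a v ->
  psi (vgen v) = phi (vgen v) ^ phi (lgen a) -> clen psi v < clen phi v.
Proof.
move=> vc vc' va lt e; have cv := cword_conj v vc.
have [u1 [u2 [eu _ es]]] := toward_cut vc va lt cv.
apply: leq_ltn_trans (clen_min (u := u1 ++ u2) vc' _) _.
  by rewrite /conj_by e cv -conjgM es.
by rewrite /clen eu !size_cat /= addnS.
Qed.

(** The first cut leaves a suffix that conjugates [b.1]; the second cut is made inside this suffix,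
    so two letters disappear. *)
Lemma toward_clen2 phi psi a b v : vertex_conj phi -> vertex_conj psi ->
  v \notin st b.1 -> b.1 \notin st a.1 -> toward phi b v -> toward phi a b.1 ->
  psi (vgen v) = phi (vgen v) ^ (phi (lgen b) * phi (lgen a)) ->
  clen psi v < clen phi v.
Proof.
move=> vc vc' vb ba ltv ltb e; have cv := cword_conj v vc.
have [u1 [u2 [eu cb es]]] := toward_cut vc vb ltv cv.
have [u3 [u4 [eu2 _ es']]] := toward_cut vc ba ltb cb.
apply: leq_ltn_trans (clen_min (u := u1 ++ (u3 ++ u4)) vc' _) _.
  by rewrite /conj_by e cv -conjgM mulgA es gw_cat -mulgA es' -gw_cat.
by rewrite /clen eu !size_cat /= eu2 !size_cat /=; lia.
Qed.

Lemma slab_away phi x v : slab phi x v <> 0%R ->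
  exists a, a.1 = x /\ toward phi a v.
Proof.
move=> n0; exists (x, (0 < slab phi x v)%R); split=> //.
by rewrite /toward /sgl /=; case: ifP; lia.
Qed.

(** If [slab phi x y] is nonzero, a proper suffix of the shortest conjugator of [y] already
    conjugates [x], so [x] has the shorter conjugator. This cannot hold both ways. *)
Lemma slab_antisym phi x y : vertex_conj phi -> y \notin st x -> x \notin st y ->
  slab phi x y = 0%R \/ slab phi y x = 0%R.
Proof.
move=> vc yx xy.
have half v w : w \notin st v -> slab phi v w <> 0%R -> clen phi v < clen phi w.
  move=> wv /slab_away[a [av ta]]; rewrite -av in wv *.
  have [u1 [u2 [eu cu _]]] := toward_cut vc wv ta (cword_conj w vc).
  apply: leq_ltn_trans (clen_min vc cu) _.
  by rewrite /clen eu size_cat /= addnS ltnS leq_addl.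
have [?|/eqP h1] := eqVneq (slab phi x y) 0%R; first by left.
have [?|/eqP h2] := eqVneq (slab phi y x) 0%R; first by right.
by have := half _ _ yx h1; have := half _ _ xy h2; lia.
Qed.

(* Along a path towards the coset of phi v, the x-coordinate changes only on the
   coset of phi x, where the y-coordinate is slab phi y x, and vice versa: in Z^2
   the path stays on the cross through the point (slab phi x y, slab phi y x). *)
Lemma slab_cross phi x y v : vertex_conj phi -> y \notin st x -> x \notin st y ->
  v \notin st x -> v \notin st y ->
  slab phi y v = slab phi y x \/ slab phi x v = slab phi x y.
Proof.
move=> vc yx xy vx vy.
have [xy' nxy] := notin_st yx; have [yx' nyx] := notin_st xy.
have cx := cword_conj x vc; have cy := cword_conj y vc; have cv := cword_conj v vc.
rewrite (slabE vc vx cv cx) (slabE vc vy cv cy).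
have ok := slab_antisym vc yx xy; move: ok.
rewrite (slabE vc yx cy cx) (slabE vc xy cx cy).
move: cx cy {cv}; move: (gw (cword phi x)) (gw (cword phi y)) => h k cx cy ok.
have dx p : commute (vgen x) (p / h) -> disp y (p / k) = disp y (h / k).
  move=> c; rewrite -(disp_centralizer (h / k) yx' nyx c) mulgA mulgVK //.
have dy p : commute (vgen y) (p / k) -> disp x (p / h) = disp x (k / h).
  move=> c; rewrite -(disp_centralizer (k / h) xy' nxy c) mulgA mulgVK //.
(* The empty suffix has both coordinates 0 and lies on the cross by [slab_antisym]; a letter that
   changes one coordinate pins the other by [dx] or [dy]. *)
elim: (cword phi v) => [|a u IH].
  by rewrite !mul1g; lia.
rewrite gw_cons -!mulgA !disp_lgen_mul.
case: ifP => [/andP[/eqP ay /asboolP c]|_]; case: ifP => [/andP[/eqP ax /asboolP c']|_].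
- by rewrite -ax -ay eqxx in xy'.
- by right; rewrite -(dy _ c) GRing.add0r.
- by left; rewrite -(dx _ c') GRing.add0r.
- by rewrite !GRing.add0r.
Qed.

Lemma slab_nested phi x y v : vertex_conj phi -> y \notin st x -> x \notin st y ->
  v \notin st x -> v \notin st y ->
  slab phi x y <> 0%R -> slab phi y v <> 0%R -> slab phi x v = slab phi x y.
Proof.
move=> vc yx xy vx vy sxy syv.
have [//|syx] := slab_antisym vc yx xy.
by have [] := slab_cross vc yx xy vx vy; rewrite ?syx.
Qed.

End VertexConj.

(** * Unions of components of the complement of a star *)

Section Components.
Variable Gamma : sgraph.
Implicit Types (v w x y : Gamma) (A Y Z : {set Gamma}).

Lemma union_of_componentsP A Y :
  reflect (Y \subset A /\ forall v w, v \in Y -> w \in A -> adj v w -> w \in Y)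
    (union_of_components A Y).
Proof.
apply: (iffP idP) => [h|[YA Yadj]].
  by split=> [|v w]; [exact: union_of_components_sub | exact: union_of_components_closed].
pose r := [rel v w : Gamma | [&& v \in A, w \in A & adj v w]].
apply/existsP; exists [set [set w in A | connect r v w] | v in Y].
apply/andP; split.
  by apply/subsetP => _ /imsetP[v /(subsetP YA) vA ->]; exact: imset_f.
have Yr : closed r Y.
  apply: intro_closed => [|v w /and3P[_ wA vw] vY]; last exact: Yadj vw.
  by apply: sym_connect_sym => v w; rewrite /= adj_sym andbCA.
rewrite eqEsubset; apply/andP; split; apply/subsetP => v.
  move=> vY; apply/bigcupP; exists [set w in A | connect r v w]; first exact: imset_f.
  by rewrite inE (subsetP YA) ?connect0.
case/bigcupP => _ /imsetP[w wY ->]; rewrite inE => /andP[_ wv].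
by rewrite -(closed_connect Yr wv).
Qed.

Definition outer_union x Y := union_of_components (~: st x) Y.

Lemma outer_unionP x Y :
  reflect ((forall v, v \in Y -> v \notin st x) /\
           forall v w, v \in Y -> w \notin st x -> adj v w -> w \in Y)
    (outer_union x Y).
Proof.
apply: (iffP (union_of_componentsP _ _)) => -[YA Yadj]; split.
- by move=> v /(subsetP YA); rewrite in_setC.
- by move=> v w vY wx; apply: Yadj; rewrite ?in_setC.
- by apply/subsetP => v /YA; rewrite in_setC.
- by move=> v w vY; rewrite in_setC; exact: Yadj.
Qed.

Lemma outer_notin_st x Y v : outer_union x Y -> v \in Y -> v \notin st x.
Proof. by case/outer_unionP => + _; exact. Qed.

Lemma outer_base x Y : outer_union x Y -> x \notin Y.
Proof. by move=> h; apply/negP => /(outer_notin_st h); rewrite !inE eqxx. Qed.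

Lemma outer_adj x Y v w : outer_union x Y -> v \in Y -> w \notin Y -> adj v w ->
  w = x \/ adj x w.
Proof.
case/outer_unionP => _ h vY wY vw.
have : w \in st x by apply: contraNT wY => wx; exact: h vw.
by rewrite !inE => /orP[/eqP|]; [left|right].
Qed.

Lemma outer_set0 x : outer_union x set0.
Proof. by apply/outer_unionP; split=> v; rewrite in_set0. Qed.

Lemma outer_setC x : outer_union x (~: st x).
Proof. by apply/outer_unionP; split=> [v|v w _ wx _]; rewrite in_setC. Qed.

Lemma outer_setU x Y Z :
  outer_union x Y -> outer_union x Z -> outer_union x (Y :|: Z).
Proof.
move=> /outer_unionP[Ys Ya] /outer_unionP[Zs Za]; apply/outer_unionP; split.
  by move=> v; rewrite in_setU => /orP[/Ys|/Zs].
move=> v w /setUP[vY|vZ] wx vw; apply/setUP.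
  by left; exact: Ya vw.
by right; exact: Za vw.
Qed.

Lemma outer_setD x Y Z :
  outer_union x Y -> outer_union x Z -> outer_union x (Y :\: Z).
Proof.
move=> /outer_unionP[Ys Ya] /outer_unionP[Zs Za]; apply/outer_unionP; split.
  by move=> v; rewrite in_setD => /andP[_ /Ys].
move=> v w /setDP[vY vZ] wx vw; apply/setDP; split; first exact: Ya vw.
by apply: contra vZ => wZ; apply: (Za w v) => //; [exact: Ys | rewrite adj_sym].
Qed.

Definition outer_rel x := [rel v w : Gamma | [&& v \notin st x, w \notin st x & adj v w]].

Definition outer_comp x v : {set Gamma} :=
  [set w in ~: st x | connect (outer_rel x) v w].

Lemma outer_rel_sym x : connect_sym (outer_rel x).
Proof. by apply: sym_connect_sym => v w; rewrite /= adj_sym andbCA. Qed.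

Lemma outer_compE x v w :
  (w \in outer_comp x v) = (w \notin st x) && connect (outer_rel x) v w.
Proof. by rewrite in_set in_setC. Qed.

Lemma outer_comp_self x v : v \notin st x -> v \in outer_comp x v.
Proof. by rewrite outer_compE connect0 andbT. Qed.

Lemma outer_comp_union x v : outer_union x (outer_comp x v).
Proof.
apply/outer_unionP; split=> [w|w z]; rewrite outer_compE => /andP[] //.
move=> wx vw zx wz; rewrite outer_compE zx; apply: connect_trans vw _.
by apply: connect1; rewrite /= wx zx.
Qed.

Lemma outer_comp_sub x v Y : outer_union x Y -> v \in Y -> outer_comp x v \subset Y.
Proof.
case/outer_unionP => Ys Ya vY; apply/subsetP => w; rewrite outer_compE => /andP[_ vw].
rewrite -(closed_connect (a := Y) _ vw) //.
apply: intro_closed => [|a b /and3P[_ bx ab] aY]; first exact: outer_rel_sym.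
exact: Ya ab.
Qed.

Lemma outer_comp_const x v w (T : Type) (f : Gamma -> T) :
  (forall a b, a \notin st x -> b \notin st x -> adj a b -> f a = f b) ->
  w \in outer_comp x v -> f w = f v.
Proof.
move=> fc; rewrite outer_compE => /andP[_ /connectP[p]].
elim: p v => [|a p IH] v /=; first by move=> _ ->.
by case/andP=> /and3P[vx ax va] pa ew; rewrite (IH a) // -(fc v).
Qed.

Lemma outer_comp_eq x v w : w \in outer_comp x v -> outer_comp x w = outer_comp x v.
Proof.
rewrite outer_compE => /andP[_ vw]; apply/setP => z; rewrite !outer_compE.
by rewrite (same_connect (@outer_rel_sym x) vw).
Qed.

(* A component of Gamma \ st(y) that avoids x does not meet st(x). *)
Lemma outer_comp_absorb x y d Y v : y \notin st x ->
  x \notin outer_comp y d -> outer_union x Y ->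
  v \in outer_comp y d -> v \in Y -> outer_comp y d \subset Y.
Proof.
move=> yx xD hY vD vY; have hD := outer_comp_union y d.
have [xy nxy] := notin_st yx.
have xy' : x \notin st y by rewrite !inE negb_or xy adj_sym.
rewrite -(outer_comp_eq vD); move: (outer_comp y d) xD vD hD => D xD vD hD.
apply: (subset_trans _ (subsetIr D Y)); apply: outer_comp_sub; last exact/setIP.
have [Ds Da] := outer_unionP _ _ hD; have [Ys Ya] := outer_unionP _ _ hY.
apply/outer_unionP; split=> [w /setIP[wD wY]|w z /setIP[wD wY] zy wz]; first exact: Ds.
have zD := Da _ _ wD zy wz; apply/setIP; split=> //; apply: (Ya w) => //.
rewrite !inE negb_or; apply/andP; split; first by apply: contraNneq xD => <-.
by apply: contra xD => xz; apply: (Da z) => //; rewrite adj_sym.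
Qed.

(** If [d] were [x] or adjacent to it, [x] would belong to the component of [d]; hence [d] is
    outside [st x] and absorption applies. *)
Lemma outer_comp_sub_comp x y d : y \notin st x ->
  d \notin st y -> x \notin outer_comp y d ->
  d \notin st x /\ outer_comp y d \subset outer_comp x d.
Proof.
move=> yx dy xD; have dD := outer_comp_self dy.
have [xy nxy] := notin_st yx.
have dx : d \notin st x.
  rewrite !inE negb_or; apply/andP; split; first by apply: contraNneq xD => <-.
  apply: contra xD => xd; have [_ Da] := outer_unionP _ _ (outer_comp_union y d).
  by apply: (Da d) => //; rewrite ?(adj_sym d) // !inE negb_or xy adj_sym.
split=> //; apply: (outer_comp_absorb yx xD (outer_comp_union x d) dD).
exact: outer_comp_self.
Qed.

End Components.

(** * Partial conjugations, as automorphisms and as elements of the presented group *)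

Section PartialConj.
Variable Gamma : sgraph.
Implicit Types (v w x y : Gamma) (a b : letter Gamma) (Y Z : {set Gamma}).
Implicit Types (g h : raag Gamma) (phi psi : aut (raag Gamma)).

Notation P := (presented (@pc_rel Gamma)).

(* Unlike [pc_symbol], these allow the empty union of components, for which the
   partial conjugation is the identity. *)
Definition pc_aut a Y : aut (raag Gamma) :=
  if insub (a, Y) is Some s then partial_conj s else 1.

Definition pc_elt a Y : P := if insub (a, Y) is Some s then pgen (@pc_rel Gamma) s else 1.

Lemma pc_symbolP a Y : outer_union a.1 Y ->
  (Y = set0 /\ pc_aut a Y = 1 /\ pc_elt a Y = 1) \/
  exists s : pc_symbol Gamma, [/\ pc_base s = a, pc_supp s = Y,
    pc_aut a Y = partial_conj s & pc_elt a Y = pgen (@pc_rel Gamma) s].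
Proof.
move=> hY; rewrite /pc_aut /pc_elt; have [Y0|Y0] := eqVneq Y set0.
  by left; rewrite insubF // /is_pc_symbol /= Y0 eqxx.
have h : is_pc_symbol (a, Y) by rewrite /is_pc_symbol /= Y0.
by right; exists (Sub _ h); rewrite insubT /pc_base /pc_supp SubK.
Qed.

Lemma pc_aut_symbol s : pc_aut (pc_base s) (pc_supp s) = partial_conj s.
Proof. by rewrite /pc_aut /pc_base /pc_supp -surjective_pairing valK. Qed.

Lemma pc_elt_symbol s :
  pc_elt (pc_base s) (pc_supp s) = pgen (@pc_rel Gamma) s.
Proof. by rewrite /pc_elt /pc_base /pc_supp -surjective_pairing valK. Qed.

Lemma pc_autE a Y v : outer_union a.1 Y ->
  pc_aut a Y (vgen v) = vgen v ^ (if v \in Y then lgen a else 1).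
Proof.
move=> /pc_symbolP[[-> [-> _]]|[s [<- <- -> _]]]; first by rewrite in_set0 conjg1.
by rewrite partial_conjE; case: ifP; rewrite ?conjg1 // conjgE mulgA.
Qed.

Lemma pc_aut_lgen a Y b : outer_union a.1 Y -> b.1 \notin Y ->
  pc_aut a Y (lgen b) = lgen b.
Proof.
move=> hY bY; rewrite (conj_by_lgen (g := 1)) ?conjg1 //.
by rewrite /conj_by pc_autE // (negbTE bY).
Qed.

Lemma aut_ext phi psi : (forall v, phi (vgen v) = psi (vgen v)) -> phi = psi.
Proof. by move=> e; apply: aut_eq; apply: pres_morph_eq => //; exact: autM. Qed.

Lemma pc_autV a Y : outer_union a.1 Y -> pc_aut a Y * pc_aut (linv a) Y = 1.
Proof.
move=> hY; apply: aut_ext => v; rewrite /= !pc_autE // autJ pc_autE //.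
case: ifP => _; last by rewrite aut1 !conjg1.
by rewrite pc_aut_lgen ?outer_base // lgen_linv conjgK.
Qed.

Lemma pc_autU a Y Z : outer_union a.1 Y -> outer_union a.1 Z -> [disjoint Y & Z] ->
  pc_aut a Y * pc_aut a Z = pc_aut a (Y :|: Z).
Proof.
move=> hY hZ dYZ; apply: aut_ext => v; rewrite /= !pc_autE ?outer_setU // autJ pc_autE //.
rewrite in_setU; have [vY|_] := boolP (v \in Y) => /=.
  by rewrite (disjointFr dYZ vY) aut1 conjg1.
by case: ifP => _; rewrite ?aut1 !conjg1 // pc_aut_lgen ?outer_base.
Qed.

Lemma pc_aut_comm a b Y Z : outer_union a.1 Y -> outer_union b.1 Z ->
  a.1 \notin Z -> b.1 \notin Y -> [disjoint Y & Z] \/ adj a.1 b.1 ->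
  commute (pc_aut a Y) (pc_aut b Z).
Proof.
move=> hY hZ aZ bY h; apply: aut_ext => v; rewrite /= !pc_autE // !autJ !pc_autE //.
have [vY|vY] := boolP (v \in Y); have [vZ|vZ] := boolP (v \in Z);
  rewrite ?aut1 ?conjg1 ?pc_aut_lgen //.
case: h => [d|ab]; first by rewrite (disjointFr d vY) in vZ.
have c : commute (lgen b) (lgen a).
  by apply: lgen_commP; apply: commute_sym; exact: lgen_comm.
by rewrite -!conjgM c.
Qed.

Lemma pc_aut_inner b g : pc_aut b (~: st b.1) g = g ^ lgen b.
Proof.
move: g; apply: pres_morph_eq => [g h|g h|v]; rewrite ?autM ?conjMg //.
rewrite -/(vgen v) pc_autE ?outer_setC // in_setC; case: ifP => // /negbT.
rewrite negbK !inE conjg1 => /orP[/eqP ->|bv].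
  apply/esym/conjg_fixP/commgP; apply: commute_sym; apply: lgen_commP.
  exact: commute_refl.
by apply/esym/conjg_fixP/commgP; apply: commute_sym; exact: lgen_comm.
Qed.

Lemma pc_aut_inner_comm a b Y : outer_union a.1 Y -> b.1 \notin Y ->
  commute (pc_aut b (~: st b.1)) (pc_aut a Y).
Proof.
move=> hY bY; apply: aut_ext => v.
by rewrite [LHS]pc_aut_inner [RHS]/= pc_aut_inner autJ pc_aut_lgen.
Qed.

Lemma weval_wgen (s : pc_symbol Gamma) :
  weval (@partial_conj Gamma) (wgen s) = partial_conj s.
Proof. by rewrite /weval big_seq1. Qed.

Lemma weval_winv (u : word (pc_symbol Gamma)) :
  weval (@partial_conj Gamma) (winv u) = (weval (@partial_conj Gamma) u)^-1.
Proof.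
apply: (@mulgI _ (weval (@partial_conj Gamma) u)); rewrite mulgV -weval_cat.
(* Only free cancellation is invoked: compatibility with [pc_rel] is derived from this lemma. *)
rewrite (weval_eq (R := fun _ _ => False) _ (word_eq_mulV _ u)) //.
by rewrite /weval big_nil.
Qed.

Lemma weval_omega b : weval (@partial_conj Gamma) (omega b) = pc_aut b (~: st b.1).
Proof.
by rewrite /omega /pc_aut; case: insub => [s|]; rewrite ?weval_wgen // /weval big_nil.
Qed.

Lemma partial_conj_respects : respects_rel (@pc_rel Gamma) (@partial_conj Gamma).
Proof.
move=> _ _ [c c' eb es|c d e bd be dis es|c d cd dc _ _ h|c b bc _ _];
  rewrite ?weval_cat ?weval_winv ?weval_omega !weval_wgen -!pc_aut_symbol.
- apply: (@mulgI _ (pc_aut (pc_base c) (pc_supp c))).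
  by rewrite mulgV eb es pc_autV //; exact: pc_supp_union.
- rewrite bd be es pc_autU //; first exact: pc_supp_union.
  by rewrite /outer_union -bd; exact: pc_supp_union.
- apply: pc_aut_comm => //; try exact: pc_supp_union.
  by case: h => h; [left|right]; rewrite // inE in h; move: h; rewrite inE.
- by rewrite mulgA (pc_aut_inner_comm (pc_supp_union c) bc) mulgK.
Qed.

Definition pc_hom : P -> aut (raag Gamma) := pres_lift (@partial_conj Gamma).

Lemma pc_homM : {morph pc_hom : u v / u * v}.
Proof. exact: pres_liftM partial_conj_respects. Qed.

Lemma pc_hom_gen s : pc_hom (pgen (@pc_rel Gamma) s) = partial_conj s.
Proof. exact: pres_lift_gen partial_conj_respects s. Qed.

Lemma pc_hom1 : pc_hom 1 = 1.
Proof. by apply: (@mulgI _ (pc_hom 1)); rewrite -pc_homM !mulg1. Qed.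

Lemma pc_homV u : pc_hom u^-1 = (pc_hom u)^-1.
Proof. by apply: (@mulgI _ (pc_hom u)); rewrite -pc_homM !mulgV pc_hom1. Qed.

Lemma pc_hom_elt a Y : outer_union a.1 Y -> pc_hom (pc_elt a Y) = pc_aut a Y.
Proof.
move=> /pc_symbolP[[_ [-> ->]]|[s [_ _ -> ->]]]; first exact: pc_hom1.
exact: pc_hom_gen.
Qed.

Lemma pc_eltV a Y : outer_union a.1 Y -> (pc_elt a Y)^-1 = pc_elt (linv a) Y.
Proof.
move=> hY; case: (pc_symbolP hY) => [[Y0 [_ ->]]|[s [sa sY _ ->]]].
  case: (@pc_symbolP (linv a) Y hY) => [[_ [_ ->]]|[s [_ sY _ _]]]; first exact: invg1.
  by have /andP[/negP[]] := valP s; rewrite -/(pc_supp s) sY Y0.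
case: (@pc_symbolP (linv a) Y hY) => [[Y0 _]|[s' [sa' sY' _ ->]]].
  by have /andP[/negP[]] := valP s; rewrite -/(pc_supp s) sY Y0.
rewrite -[LHS]pclassV; apply/pclassP/word_eq_rel/pc_rel_inv; first by rewrite sa' sa.
by rewrite sY' sY.
Qed.

Lemma pc_elt0 a : pc_elt a set0 = 1.
Proof. by rewrite /pc_elt insubF // /is_pc_symbol /= eqxx. Qed.

Lemma pc_eltU a Y Z : outer_union a.1 Y -> outer_union a.1 Z -> [disjoint Y & Z] ->
  pc_elt a (Y :|: Z) = pc_elt a Y * pc_elt a Z.
Proof.
move=> hY hZ dYZ.
case: (pc_symbolP hY) => [[-> _]|[s [sa sY _ eY]]].
  by rewrite set0U pc_elt0 mul1g.
case: (pc_symbolP hZ) => [[-> _]|[t [ta tZ _ eZ]]].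
  by rewrite setU0 pc_elt0 mulg1.
case: (pc_symbolP (outer_setU hY hZ)) => [[/eqP + _]|[r [ra rU _ ->]]].
  rewrite setU_eq0 => /andP[/eqP Y0 _].
  by have /andP[/negP[]] := valP s; rewrite -/(pc_supp s) sY Y0.
rewrite eY eZ /pgen -[RHS]pclassM; apply/esym/pclassP/word_eq_rel/pc_rel_union.
- by rewrite ta.
- by rewrite ra.
- by rewrite sY tZ.
- by rewrite sY tZ rU.
Qed.

Lemma pc_elt_comm a b Y Z : outer_union a.1 Y -> outer_union b.1 Z ->
  a.1 \notin Z -> b.1 \notin Y -> a.1 != b.1 -> [disjoint Y & Z] \/ adj a.1 b.1 ->
  commute (pc_elt a Y) (pc_elt b Z).
Proof.
move=> hY hZ aZ bY ab h.
case: (pc_symbolP hY) => [[-> _]|[s [sa sY _ ->]]].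
  by rewrite pc_elt0; apply: commute_sym; exact: commute1.
case: (pc_symbolP hZ) => [[-> _]|[t [tb tZ _ ->]]].
  by rewrite pc_elt0; exact: commute1.
rewrite /commute /pgen -[LHS]pclassM -[RHS]pclassM; apply/pclassP/word_eq_rel/pc_rel_comm.
- by rewrite sa tZ.
- by rewrite sY tb.
- by rewrite sa tb => e; rewrite e eqxx in ab.
- by rewrite sa tb => e; rewrite e eqxx in ab.
- by rewrite sa tb sY tZ inE inE; case: h; [left|right].
Qed.

Lemma pc_elt_inner_comm a b Y : outer_union a.1 Y -> b.1 \notin Y -> a.1 != b.1 ->
  commute (pc_elt b (~: st b.1)) (pc_elt a Y).
Proof.
move=> hY bY ab; case: (pc_symbolP hY) => [[-> _]|[s [sa sY _ ->]]].
  by rewrite pc_elt0; exact: commute1.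
have -> : pc_elt b (~: st b.1) = pclass (@pc_rel Gamma) (omega b).
  by rewrite /pc_elt /omega; case: insub.
have : pclass (@pc_rel Gamma) (omega b ++ wgen s ++ winv (omega b)) =
       pgen (@pc_rel Gamma) s.
  apply/pclassP/word_eq_rel/pc_rel_omega; first by rewrite sY.
  - by rewrite sa => e; rewrite e eqxx in ab.
  - by rewrite sa => e; rewrite e eqxx in ab.
rewrite !pclassM pclassV => e; rewrite /commute -[X in _ = X * _]e.
by rewrite -/(pgen _ _) -!mulgA mulVg mulg1.
Qed.

(* The partial conjugation by the complement of Y differs from the inverse of
   [pc_elt a Y] by an inner automorphism. *)
Lemma pc_elt_nested_comm a b Y Z : outer_union a.1 Y -> outer_union b.1 Z ->
  a.1 \notin Z -> b.1 \in Y -> Z \subset Y -> commute (pc_elt a Y) (pc_elt b Z).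
Proof.
move=> hY hZ aZ bY ZY.
have ab : a.1 != b.1 by apply: contraTneq bY => <-; exact: outer_base.
have hC := outer_setD (outer_setC a.1) hY.
have e : pc_elt a (~: st a.1) = pc_elt a Y * pc_elt a (~: st a.1 :\: Y).
  rewrite -pc_eltU //; last by rewrite -setI_eq0 setIDA setIC -setIDA setDv setI0.
  congr pc_elt; apply/setP => v; rewrite in_setU in_setD in_setC.
  by case: (boolP (v \in Y)) => //= /(outer_notin_st hY) ->.
have -> : pc_elt a Y = pc_elt a (~: st a.1) / pc_elt a (~: st a.1 :\: Y).
  by rewrite e mulgK.
apply: commute_sym; apply: commuteM.
  by apply: commute_sym; apply: pc_elt_inner_comm; rewrite // eq_sym.
apply: commuteV; apply: commute_sym; apply: pc_elt_comm => //.
  by rewrite in_setD bY.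
left; rewrite -setI_eq0; apply/eqP/setP => v; rewrite in_setI in_setD in_set0.
by apply/negP => /andP[/andP[vY _] /(subsetP ZY)]; rewrite (negbTE vY).
Qed.

(** Relation 1 turns an inverse letter into a generator with inverse base. *)
Lemma pc_elt_ind (Q : P -> Prop) : Q 1 ->
  (forall u a Y, outer_union a.1 Y -> Q u -> Q (u * pc_elt a Y)) -> forall u, Q u.
Proof.
move=> Q1 QM u; rewrite -(preprK u); elim/last_ind: (prepr u) => [//|w [s i] IH].
rewrite -cats1 pclassM.
suff [a [Y [hY ->]]] : exists a Y,
    outer_union a.1 Y /\ pclass (@pc_rel Gamma) [:: (s, i)] = pc_elt a Y by exact: QM.
have hs := pc_supp_union s; case: i.
  exists (linv (pc_base s)), (pc_supp s); split=> //.
  by rewrite -pc_eltV // pc_elt_symbol; exact: pclassV _ (wgen s).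
by exists (pc_base s), (pc_supp s); rewrite pc_elt_symbol.
Qed.

End PartialConj.

(** * Lengths of elements and peak reduction in the Cayley graph *)

Section PeakReduction.
Variable Gamma : sgraph.
Implicit Types (v w x y c d : Gamma) (a b : letter Gamma) (Y Z : {set Gamma}).
Implicit Types (g h : raag Gamma) (phi psi : aut (raag Gamma)).

Notation P := (presented (@pc_rel Gamma)).

Lemma mul_pc_autE phi a Y v : outer_union a.1 Y ->
  (phi * pc_aut a Y) (vgen v) = phi (vgen v) ^ (if v \in Y then phi (lgen a) else 1).
Proof.
by move=> hY; rewrite /= pc_autE // autJ; case: ifP; rewrite ?aut1.
Qed.

Lemma vertex_conj1 : vertex_conj (1 : aut (raag Gamma)).
Proof. by move=> v w _; exists 1; rewrite /conj_by !conjg1. Qed.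

Lemma vertex_conj_mul phi a Y : outer_union a.1 Y -> vertex_conj phi ->
  vertex_conj (phi * pc_aut a Y).
Proof.
move=> hY vc.
(* An edge that leaves [Y] ends at a vertex commuting with [a], so both of its ends may be
   conjugated by [phi (lgen a)]. *)
have fixed v w : v \in Y -> w \notin Y -> (v == w) || adj v w ->
    phi (vgen w) ^ phi (lgen a) = phi (vgen w).
  move=> vY wY /orP[/eqP vw|vw]; first by rewrite -vw vY in wY.
  rewrite -autJ; congr (phi _); apply/conjg_fixP/commgP; apply: commute_sym.
  case: (outer_adj hY vY wY vw) => [->|]; last exact: lgen_comm.
  by apply: lgen_commP; exact: commute_refl.
move=> v w vw; have [g [vg wg]] := vc v w vw; rewrite /conj_by !mul_pc_autE //.
have [vY|vY] := boolP (v \in Y); have [wY|wY] := boolP (w \in Y).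
- by exists (g * phi (lgen a)); rewrite vg wg !conjgM.
- by exists (g * phi (lgen a)); rewrite conjg1 -(fixed v w) // vg wg !conjgM.
- exists (g * phi (lgen a)); rewrite conjg1 -(fixed w v) // ?vg ?wg ?conjgM //.
  by rewrite eq_sym adj_sym.
- by exists g; rewrite !conjg1.
Qed.

Lemma pc_hom_mul u a Y : outer_union a.1 Y ->
  pc_hom (u * pc_elt a Y) = pc_hom u * pc_aut a Y.
Proof. by move=> hY; rewrite pc_homM pc_hom_elt. Qed.

Lemma pc_hom_vertex_conj (u : P) : vertex_conj (pc_hom u).
Proof.
move: u; apply: pc_elt_ind => [|u a Y hY vc].
  by rewrite pc_hom1; exact: vertex_conj1.
by rewrite pc_hom_mul //; exact: vertex_conj_mul.
Qed.

Definition len (u : P) := \sum_v clen (pc_hom u) v.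

Lemma len_lt (u u' : P) w : clen (pc_hom u') w < clen (pc_hom u) w ->
  (forall v, clen (pc_hom u') v <= clen (pc_hom u) v) -> len u' < len u.
Proof.
move=> ltw le; rewrite /len (bigD1 w) //= [X in _ < X](bigD1 w) //=.
by rewrite -addSn leq_add // leq_sum.
Qed.

(** As [b.1] lies outside [Y], the first move preserves the multiplier of the second, and both are
    read at [u]. On the overlap of the supports, [toward_clen2] applies. *)
Lemma len_mul2_lt u a Y b Z w : outer_union a.1 Y -> outer_union b.1 Z ->
  b.1 \notin Y ->
  (forall v, v \in Y -> toward (pc_hom u) a v) ->
  (forall v, v \in Z -> toward (pc_hom u) b v) ->
  (forall v, v \in Y -> v \in Z -> a.1 \notin st b.1 /\ toward (pc_hom u) b a.1) ->
  w \in Y :|: Z -> len (u * pc_elt a Y * pc_elt b Z) < len u.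
Proof.
move=> hY hZ bY tY tZ tYZ wYZ.
have vc := pc_hom_vertex_conj u.
have vc' := pc_hom_vertex_conj (u * pc_elt a Y * pc_elt b Z).
have e v : pc_hom (u * pc_elt a Y * pc_elt b Z) (vgen v) =
    pc_hom u (vgen v) ^ ((if v \in Y then pc_hom u (lgen a) else 1) *
                         (if v \in Z then pc_hom u (lgen b) else 1)).
  rewrite !pc_hom_mul // mul_pc_autE // mul_pc_autE // conjgM; congr (_ ^ _).
  by case: ifP => // _; rewrite /= pc_aut_lgen.
have lt v : v \in Y :|: Z ->
    clen (pc_hom (u * pc_elt a Y * pc_elt b Z)) v < clen (pc_hom u) v.
  move=> vYZ; have := e v; move: vYZ; rewrite in_setU.
  have [vY|vY] := boolP (v \in Y); have [vZ|vZ] := boolP (v \in Z) => // _ ev.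
  - have [ab ta] := tYZ v vY vZ.
    apply: (toward_clen2 vc vc' _ ab (tY v vY) ta ev); exact: outer_notin_st vY.
  - rewrite mulg1 in ev; apply: (toward_clen vc vc' _ (tY v vY) ev).
    exact: outer_notin_st vY.
  - rewrite mul1g in ev; apply: (toward_clen vc vc' _ (tZ v vZ) ev).
    exact: outer_notin_st vZ.
apply: (len_lt (lt w wYZ)) => v.
have [/lt/ltnW //|] := boolP (v \in Y :|: Z).
rewrite in_setU negb_or => /andP[/negbTE vY /negbTE vZ].
by have := e v; rewrite vY vZ mulg1 conjg1 => /clen_eq ->.
Qed.

Lemma len_mul_lt u a Y w : outer_union a.1 Y ->
  (forall v, v \in Y -> toward (pc_hom u) a v) -> w \in Y ->
  len (u * pc_elt a Y) < len u.
Proof.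
move=> hY tY wY; rewrite -[X in len X]mulg1 -(pc_elt0 a).
apply: (len_mul2_lt (w := w)) => //; rewrite ?setU0 //; first exact: outer_set0.
- exact: outer_base.
- by move=> v; rewrite in_set0.
- by move=> v _; rewrite in_set0.
Qed.

(** If [g] and [h] conjugate [v] and [a.1], the new conjugator of [v] times [h^-1] is
    [g * h^-1 * lgen a], whose last factor adds [sgl a]. *)
Lemma slab_mul_pc_aut phi a Y v : vertex_conj phi -> outer_union a.1 Y -> v \in Y ->
  slab (phi * pc_aut a Y) a.1 v = (slab phi a.1 v + sgl a)%R.
Proof.
move=> vc hY vY; have vx := outer_notin_st hY vY.
have vc' := vertex_conj_mul hY vc.
have cv := cword_conj v vc; have cx := cword_conj a.1 vc.
have cx' : conj_by (phi * pc_aut a Y) a.1 (pclass _ (cword phi a.1)).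
  by rewrite /conj_by mul_pc_autE // (negbTE (outer_base hY)) conjg1.
have cv' : conj_by (phi * pc_aut a Y) v (pclass _ (cword phi v) * phi (lgen a)).
  by rewrite /conj_by mul_pc_autE // vY cv conjgM.
rewrite (slabE vc' vx cv' cx') (slabE vc vx cv cx) (conj_by_lgen cx) conjgE.
have xa : commute (vgen a.1) (lgen a).
  by apply: commute_sym; apply: lgen_commP; exact: commute_refl.
by rewrite !mulgA mulgK (disp_mulr _ xa) disp_lgen eqxx GRing.addrAC.
Qed.

(** With a common conjugator of [a.1] and [y], the change is at most a right factor [lgen a], which
    commutes with [y] and has displacement 0 along [y]. *)
Lemma slab_mul_pc_aut_adj phi a Y y v : vertex_conj phi -> outer_union a.1 Y ->
  adj a.1 y -> v \notin st y ->
  slab (phi * pc_aut a Y) y v = slab phi y v.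
Proof.
move=> vc hY xy vy.
have yY : y \notin Y.
  by apply/negP => /(outer_notin_st hY); rewrite !inE xy orbT.
have ey : (phi * pc_aut a Y) (vgen y) = phi (vgen y).
  by rewrite mul_pc_autE // (negbTE yY) conjg1.
have [vY|vY] := boolP (v \in Y); last first.
  by apply: slab_eq => //; rewrite mul_pc_autE // (negbTE vY) conjg1.
have [|g [xg yg]] := vc a.1 y; first by rewrite xy orbT.
have cv := cword_conj v vc; have vc' := vertex_conj_mul hY vc.
have yg' : conj_by (phi * pc_aut a Y) y g by rewrite /conj_by ey.
have cv' : conj_by (phi * pc_aut a Y) v (pclass _ (cword phi v) * phi (lgen a)).
  by rewrite /conj_by mul_pc_autE // vY cv conjgM.
rewrite (slabE vc' vy cv' yg') (slabE vc vy cv yg) (conj_by_lgen xg) conjgE.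
have ya : commute (vgen y) (lgen a) by apply: commute_sym; exact: lgen_comm.
rewrite !mulgA mulgK (disp_mulr _ ya) disp_lgen; case: eqVneq xy => [->|]; last by rewrite GRing.addr0.
by rewrite adj_irrefl.
Qed.

Lemma toward_slab phi psi a v w : slab psi a.1 w = slab phi a.1 v ->
  toward phi a v -> toward psi a w.
Proof. by rewrite /toward => ->. Qed.

Lemma toward_neq0 phi a v : toward phi a v -> slab phi a.1 v <> 0%R.
Proof. by rewrite /toward => + e; rewrite e GRing.mulr0. Qed.

Lemma toward_comp phi a v w : vertex_conj phi -> w \in outer_comp a.1 v ->
  toward phi a v -> toward phi a w.
Proof.
move=> vc wv; apply: toward_slab; apply: outer_comp_const wv => p q px qx pq.
exact: slab_adj.
Qed.

Lemma len_comp_lt u a c : c \notin st a.1 -> toward (pc_hom u) a c ->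
  len (u * pc_elt a (outer_comp a.1 c)) < len u.
Proof.
move=> ca tc; apply: (len_mul_lt (w := c)); first exact: outer_comp_union.
  by move=> v vc; apply: toward_comp vc tc; exact: pc_hom_vertex_conj.
exact: outer_comp_self.
Qed.

Lemma pc_eltK u a Y : outer_union a.1 Y -> u * pc_elt a Y * pc_elt (linv a) Y = u.
Proof. by move=> hY; rewrite -pc_eltV // mulgK. Qed.

(** The new slab coordinate is nonzero with the sign of [sgl a], so the inverse move is
    decreasing. *)
Lemma len_comp_gt u a c : c \notin st a.1 -> ~ toward (pc_hom u) a c ->
  len u < len (u * pc_elt a (outer_comp a.1 c)).
Proof.
move=> ca ntc; have hC := outer_comp_union a.1 c.
rewrite -[X in len X < _](pc_eltK u hC); apply: len_comp_lt => //.
rewrite /toward pc_hom_mul // slab_mul_pc_aut ?outer_comp_self //;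
  last exact: pc_hom_vertex_conj.
move: ntc; rewrite /toward sgl_linv.
by case: (sgl_cases a) => ->; lia.
Qed.

(** Edges of these Cayley graph paths use single components, on which slab coordinates are constant;
    hence every edge changes [len] strictly. *)
Inductive conn (N : nat) : P -> P -> Prop :=
| conn_refl u : len u < N -> conn N u u
| conn_step u a c u' : len u < N -> c \notin st a.1 ->
    conn N (u * pc_elt a (outer_comp a.1 c)) u' -> conn N u u'.

Lemma conn_trans N u1 u2 u3 : conn N u1 u2 -> conn N u2 u3 -> conn N u1 u3.
Proof. by elim=> // u a c u' lu ca _ IH /IH; exact: conn_step. Qed.

Lemma conn_head N u1 u2 : conn N u1 u2 -> len u1 < N.
Proof. by case. Qed.

Lemma conn_sym N u1 u2 : conn N u1 u2 -> conn N u2 u1.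
Proof.
elim=> [u lu|u a c u' lu ca /conn_head lu' IH]; first exact: conn_refl.
apply: conn_trans IH (@conn_step N _ (linv a) c _ lu' ca _).
by rewrite pc_eltK ?outer_comp_union //; exact: conn_refl.
Qed.

Lemma conn_mono N M u1 u2 : N <= M -> conn N u1 u2 -> conn M u1 u2.
Proof.
move=> NM; elim=> [u lu|u a c u' lu ca _ IH]; first exact/conn_refl/(leq_trans lu).
by apply: conn_step IH => //; exact: leq_trans lu NM.
Qed.

Lemma conn_pc_elt N u a Y : outer_union a.1 Y ->
  (forall Z, outer_union a.1 Z -> Z \subset Y -> len (u * pc_elt a Z) < N) ->
  conn N u (u * pc_elt a Y).
Proof.
have [n] := ubnP #|Y|; elim: n u Y => // n IH u Y Yn hY lt.
have lu : len u < N.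
  by have := lt set0 (outer_set0 _) (sub0set _); rewrite pc_elt0 mulg1.
have [->|[v vY]] := set_0Vmem Y; first by rewrite pc_elt0 mulg1; exact: conn_refl.
have va := outer_notin_st hY vY; have vC := outer_comp_self va.
have hC := outer_comp_union a.1 v; have CY := outer_comp_sub hY vY.
set C := outer_comp a.1 v in vC hC CY *.
have disC Z : Z \subset Y :\: C -> [disjoint C & Z].
  by rewrite subsetD disjoint_sym => /andP[].
have eY : Y = C :|: (Y :\: C) by rewrite -{1}(setID Y C) (setIidPr CY).
have hD := outer_setD hY hC.
apply: (conn_step lu va); rewrite eY pc_eltU // ?disC // mulgA.
apply: IH => // [|Z hZ ZY].
  rewrite ltnS in Yn; apply: leq_trans Yn; apply: proper_card.
  by apply/properP; split; [exact: subsetDl | exists v => //; rewrite in_setD vC].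
rewrite -mulgA -pc_eltU ?disC //; apply: lt; first exact: outer_setU.
by rewrite eY setUS.
Qed.

Lemma conn_exists u : exists N, conn N 1 u.
Proof.
move: u; apply: pc_elt_ind => [|u a Y hY [N c1u]].
  by exists (len 1).+1; exact: conn_refl.
pose M := (\max_(Z : {set Gamma}) len (u * pc_elt a Z)%g)%N.
exists (maxn N M.+1); apply: conn_trans (conn_mono (leq_maxl _ _) c1u) _.
apply: conn_mono (leq_maxr _ _) _; apply: conn_pc_elt => // Z _ _.
exact: (@leq_bigmax _ (fun Z => len (u * pc_elt a Z)%g) Z).
Qed.

Lemma conn_square N u a c b d : c \notin st a.1 -> d \notin st b.1 ->
  commute (pc_elt a (outer_comp a.1 c)) (pc_elt b (outer_comp b.1 d)) ->
  len (u * pc_elt a (outer_comp a.1 c)) < N ->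
  len (u * pc_elt b (outer_comp b.1 d)) < N ->
  len (u * pc_elt a (outer_comp a.1 c) * pc_elt b (outer_comp b.1 d)) < N ->
  conn N (u * pc_elt a (outer_comp a.1 c)) (u * pc_elt b (outer_comp b.1 d)).
Proof.
move=> ca db cab la lb lab; apply: (conn_step la db).
apply: (@conn_step N _ (linv a) c _ lab ca).
rewrite -(mulgA u) cab mulgA pc_eltK ?outer_comp_union //; exact: conn_refl.
Qed.

(* Both moves shift towards the base point, and the coset of the second
   multiplier lies in the slabs that the first one shifts: enlarging the support
   of the first move to [Y] makes the two moves commute. *)
Lemma conn_nested u a c b d : c \notin st a.1 -> d \notin st b.1 ->
  b.1 \notin st a.1 -> a.1 \notin st b.1 -> a.1 \notin outer_comp b.1 d ->
  toward (pc_hom u) a c -> toward (pc_hom u) b d -> toward (pc_hom u) a b.1 ->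
  conn (len u) (u * pc_elt a (outer_comp a.1 c)) (u * pc_elt b (outer_comp b.1 d)).
Proof.
move=> ca db ba ab aD tc td tb; have vc := pc_hom_vertex_conj u.
have [da DD'] := outer_comp_sub_comp ba db aD.
have td' : toward (pc_hom u) a d.
  apply: (toward_slab _ tb).
  exact: slab_nested vc ba ab da db (toward_neq0 tb) (toward_neq0 td).
have hC := outer_comp_union a.1 c; have cC := outer_comp_self ca.
have hD := outer_comp_union b.1 d; have dD := outer_comp_self db.
have tC v : v \in outer_comp a.1 c -> toward (pc_hom u) a v by move/toward_comp; apply.
have tD v : v \in outer_comp b.1 d -> toward (pc_hom u) b v by move/toward_comp; apply.
set C := outer_comp a.1 c in hC cC tC *.
set D := outer_comp b.1 d in hD dD tD aD DD' *.
(* These components contain [c], [b.1] and all of [D], and [a] shifts each of their vertices towards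
   0. *)
pose Y := C :|: (outer_comp a.1 b.1 :|: outer_comp a.1 d).
have hY : outer_union a.1 Y by rewrite !outer_setU ?outer_comp_union.
have bY : b.1 \in Y by rewrite !in_setU outer_comp_self // orbT.
have DY : D \subset Y.
  by apply: subset_trans DD' _; rewrite /Y setUA subsetUr.
have CY : C \subset Y by rewrite subsetUl.
have tY v : v \in Y -> toward (pc_hom u) a v.
  by rewrite !in_setU => /or3P[/tC //|/toward_comp|/toward_comp]; apply.
have ltE Z : outer_union a.1 Z -> Z \subset Y ->
    len (u * pc_elt b D * pc_elt a Z) < len u.
  move=> hZ /subsetP ZY; apply: (len_mul2_lt (w := d)) => // [v /ZY/tY //|].
  by rewrite in_setU dD.
have lt1 Z : outer_union a.1 Z -> C \subset Z -> Z \subset Y ->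
    len (u * pc_elt a Z) < len u.
  move=> hZ /subsetP CZ /subsetP ZY; apply: (len_mul_lt (w := c)) => //; last exact: CZ.
  by move=> v /ZY/tY.
have eY Z : outer_union a.1 Z -> Z \subset Y ->
    pc_elt a Y = pc_elt a Z * pc_elt a (Y :\: Z).
  move=> hZ ZY; rewrite -pc_eltU ?outer_setD //.
    by rewrite -{1}(setID Y Z) (setIidPr ZY).
  by rewrite -setI_eq0 setIDA setIC -setIDA setDv setI0.
(* The path enlarges [C] to [Y], multiplies by the move of [D], exchanges the two moves and then
   removes [Y] component by component. *)
apply: (@conn_trans _ _ (u * pc_elt a Y)).
  rewrite (eY C) // mulgA; apply: conn_pc_elt => [|Z hZ ZY]; first exact: outer_setD.
  have disCZ : [disjoint C & Z].
    by move: ZY; rewrite subsetD disjoint_sym => /andP[].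
  rewrite -mulgA -pc_eltU //; apply: lt1; rewrite ?outer_setU ?subsetUl //.
  by rewrite subUset CY (subset_trans ZY) ?subsetDl.
apply: conn_step (lt1 Y hY CY (subxx _)) db _.
have -> : u * pc_elt a Y * pc_elt b D = u * pc_elt b D * pc_elt a Y.
  by rewrite -!mulgA (pc_elt_nested_comm hY hD aD bY DY).
rewrite -[X in conn _ _ X](pc_eltK _ hY).
apply: conn_pc_elt => // Z hZ ZY.
have hZ' : outer_union a.1 (Y :\: Z) by exact: outer_setD.
rewrite -(pc_eltV (a := a)) //.
have -> : pc_elt a Y = pc_elt a (Y :\: Z) * pc_elt a Z.
  by rewrite (eY (Y :\: Z)) ?subsetDl // setDDr setDv set0U (setIidPr ZY).
by rewrite mulgA mulgK; apply: ltE; rewrite ?subsetDl.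
Qed.

(** Equal bases, adjacent bases, and disjoint supports that avoid both bases give equal moves or a
    commuting square. Otherwise one base is displaced along the axis of the other, and [conn_nested]
    applies. *)
Lemma conn_peak u a c b d : c \notin st a.1 -> d \notin st b.1 ->
  toward (pc_hom u) a c -> toward (pc_hom u) b d ->
  conn (len u) (u * pc_elt a (outer_comp a.1 c)) (u * pc_elt b (outer_comp b.1 d)).
Proof.
move=> ca db tc td; have vc := pc_hom_vertex_conj u.
have hC := outer_comp_union a.1 c; have hD := outer_comp_union b.1 d.
have lc := len_comp_lt ca tc; have ld := len_comp_lt db td.
have tC v : v \in outer_comp a.1 c -> toward (pc_hom u) a v by move/toward_comp; apply.
have tD v : v \in outer_comp b.1 d -> toward (pc_hom u) b v by move/toward_comp; apply.
have cC := outer_comp_self ca; have dD := outer_comp_self db.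
have disjoint_case : [disjoint outer_comp a.1 c & outer_comp b.1 d] ->
    b.1 \notin outer_comp a.1 c ->
    len (u * pc_elt a (outer_comp a.1 c) * pc_elt b (outer_comp b.1 d)) < len u.
  move=> dis bC; apply: (len_mul2_lt (w := c)) => //; last by rewrite in_setU cC.
  by move=> v vC; rewrite (disjointFr dis vC).
have [eab|nab] := eqVneq a.1 b.1.
  have [dC|dC] := boolP (d \in outer_comp a.1 c).
    have ta := tC _ dC.
    have -> : b = a.
      move: ta td; rewrite /toward -eab; case: a b eab {ca db tc hC hD lc ld tC tD
        cC dD disjoint_case dC} => x i [y j] /= <-.
      by case: i; case: j => //; rewrite /sgl /=; lia.
    by rewrite (outer_comp_eq dC); exact: conn_refl.
  have dis : [disjoint outer_comp a.1 c & outer_comp b.1 d].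
    rewrite -setI_eq0; apply/eqP/setP => v; rewrite in_setI in_set0.
    apply/negP => /andP[vC]; rewrite -eab => vD.
    move: dC; rewrite -(outer_comp_eq vC) (outer_comp_eq vD).
    by rewrite outer_comp_self // eab.
  apply: conn_square => //; last by apply: disjoint_case; rewrite // -eab outer_base.
  have com : commute (pc_elt a (outer_comp a.1 c)) (pc_elt a (outer_comp b.1 d)).
    have hD' : outer_union a.1 (outer_comp b.1 d) by rewrite eab.
    by rewrite /commute -(pc_eltU hC hD' dis) setUC pc_eltU // disjoint_sym.
  have [ba|nba] := eqVneq b a; first by move: com; rewrite ba.
  have eb : b = linv a.
    case: a b eab nba {ca db tc td hC hD lc ld tC tD cC dD disjoint_case dC dis com}
      => x i [y j] /= <-; rewrite /linv /=.
    by case: i; case: j => //; rewrite eqxx.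
  move: com; rewrite eb => com; rewrite -pc_eltV; last exact: outer_comp_union.
  exact: commuteV.
have [adjab|nadj] := boolP (adj a.1 b.1).
  have aD : a.1 \notin outer_comp b.1 d.
    by apply/negP => /(outer_notin_st hD); rewrite !inE adj_sym adjab orbT.
  have bC : b.1 \notin outer_comp a.1 c.
    by apply/negP => /(outer_notin_st hC); rewrite !inE adjab orbT.
  apply: conn_square => //; first by apply: pc_elt_comm => //; right.
  apply: ltn_trans lc; apply: len_comp_lt => //.
  by apply: toward_slab td; rewrite pc_hom_mul // slab_mul_pc_aut_adj.
have ba : b.1 \notin st a.1 by rewrite !inE negb_or eq_sym nab.
have ab : a.1 \notin st b.1 by rewrite !inE negb_or nab adj_sym.
have [bC|bC] := boolP (b.1 \in outer_comp a.1 c).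
  have tb := tC _ bC; apply: conn_nested => //; apply/negP => /tD ta.
  by case: (slab_antisym vc ba ab); [move/(toward_neq0 tb) | move/(toward_neq0 ta)].
have [aD|aD] := boolP (a.1 \in outer_comp b.1 d).
  by apply: conn_sym; apply: conn_nested => //; exact: tD.
have [dis|] := boolP [disjoint outer_comp a.1 c & outer_comp b.1 d].
  by apply: conn_square; rewrite ?disjoint_case //; apply: pc_elt_comm => //; left.
rewrite -setI_eq0 => /set0Pn[v /setIP[vC vD]].
have va := outer_notin_st hC vC; have vb := outer_notin_st hD vD.
(* Along one of the two axes, the common vertex [v] shares its slab with the other base, to which
   [toward] is transferred. *)
have [e|e] := slab_cross vc ba ab va vb.
  apply: conn_sym; apply: conn_nested => //.
  by apply: toward_slab (tD v vD).
by apply: conn_nested => //; apply: toward_slab (tC v vC).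
Qed.

(** Vertices of length [N] are removed by induction along the path. The second clause lets a path
    that starts at such a vertex start at any lower neighbour instead; two successive vertices of
    length [N] cannot occur, as every edge changes [len]. *)
Lemma conn_lower N u u' : conn N.+1 u u' -> len u' < N ->
  (len u < N -> conn N u u') /\
  (len u = N -> forall a c, c \notin st a.1 ->
     len (u * pc_elt a (outer_comp a.1 c)) < N ->
     conn N (u * pc_elt a (outer_comp a.1 c)) u').
Proof.
have down (v : P) a c : c \notin st a.1 -> len (v * pc_elt a (outer_comp a.1 c)) <= len v ->
    toward (pc_hom v) a c.
  by move=> ca le; apply: contrapT => /(len_comp_gt ca); rewrite ltnNge le.
elim=> [v _ lv|v a c w lv ca cw IH lw].
  by split=> [|e]; [exact: conn_refl | rewrite e ltnn in lv].
have [IH1 IH2] := IH lw; have := conn_head cw; rewrite ltnS leq_eqVlt.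
have hC := outer_comp_union a.1 c.
case/orP=> [/eqP eN|lt]; split=> [lvN|evN].
- rewrite -(pc_eltK v hC); apply: (IH2 eN (linv a) c ca).
  by rewrite pc_eltK.
- have := @len_comp_lt v a c ca; rewrite eN evN ltnn => h.
  by have := h (down _ _ _ ca _); rewrite eN evN leqnn => /(_ isT).
- exact: conn_step (IH1 lt).
- move=> b d db ltd; apply: conn_trans (IH1 lt); rewrite -evN.
  by apply: conn_peak => //; apply: down; rewrite // evN ltnW.
Qed.

Lemma len1 : len 1 = 0.
Proof.
apply: big1 => v _; apply/eqP; rewrite -leqn0 pc_hom1.
apply: (clen_min (u := [::]) vertex_conj1).
by rewrite /conj_by conjg1.
Qed.

(** All lengths on the path are 0, so it has no edge. *)
Lemma conn1_eq u u' : conn 1 u u' -> u = u'.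
Proof.
case=> // v a c w; rewrite ltnS leqn0 => /eqP lv ca /conn_head.
rewrite ltnS leqn0 => /eqP lva.
have [ta|nta] := EM (toward (pc_hom v) a c).
  by have := len_comp_lt ca ta; rewrite lv.
by have := len_comp_gt ca nta; rewrite lva.
Qed.

(** Both [1] and [u] have length 0, so the bound of a path between them can be lowered to 1. *)
Lemma pc_hom_ker (u : P) : pc_hom u = 1 -> u = 1.
Proof.
move=> u1; have lu : len u = 0 by rewrite -len1 /len u1 pc_hom1.
have [N] := conn_exists u; elim: N => [/conn_head //|[_ /conn1_eq //|N IH] c1u].
by apply: IH; apply: (conn_lower c1u _).1; rewrite ?lu ?len1.
Qed.

End PeakReduction.

Theorem theorem1p2 (Gamma : sgraph) :
  exists f : {multiplicative presented (@pc_rel Gamma) -> aut (raag Gamma)},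
    [/\ forall s : pc_symbol Gamma, f (pgen (@pc_rel Gamma) s) = partial_conj s,
        injective f
      & forall a : aut (raag Gamma), pc_group a <-> exists u, f u = a].
Proof.
pose hom_mixin := isMultiplicative.Build _ _ _ (@pc_homM Gamma).
pose f : {multiplicative presented (@pc_rel Gamma) -> aut (raag Gamma)} :=
  HB.pack (@pc_hom Gamma) hom_mixin.
exists f; split=> [s|u v /= uv|a]; first exact: pc_hom_gen.
  apply/divg1_eq/pc_hom_ker; rewrite pc_homM pc_homV.
  by rewrite (uv : pc_hom u = pc_hom v) mulgV.
split=> [|[u <-]].
  elim=> {a} [_ [s ->]||_ _ _ [u <-] _ [v <-]|_ _ [u <-]].
  - by exists (pgen (@pc_rel Gamma) s); exact: pc_hom_gen.
  - by exists 1; exact: pc_hom1.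
  - by exists (u * v); exact: pc_homM.
  - by exists u^-1; exact: pc_homV.
rewrite /f /=; move: u; apply: pc_elt_ind => [|u b Y hY IH].
  by rewrite (pc_hom1 Gamma); exact: generated_one.
rewrite pc_hom_mul //; apply: generated_mul => //.
case: (pc_symbolP hY) => [[_ [-> _]]|[s [_ _ -> _]]]; first exact: generated_one.
by apply: generated_in; exists s.
Qed.
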